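(* The space of typical $7$-configurations in $\mathbb{RP}^2$ has exactly $14$ path components (Q-deformation classes). More precisely, writing $QC^7_\sigma$ for the set of typical $7$-configurations with derivative code $\sigma$: the set $QC^7_{(3,4,0,0)}$ has exactly two path components, the set $QC^7_{(2,2,3,0)}$ has exactly three path components, and for each of the nine codes $\sigma\in\{(7,0,0,0),(1,2,2,2),(1,0,6,0),(1,6,0,0),(1,4,2,0),(1,2,4,0),(0,4,3,0),(0,6,1,0),(0,3,3,1)\}$ the set $QC^7_\sigma$ is nonempty and path-connected.
   Context: An $n$-configuration is a set of $n$ distinct (unordered) points in the real projective plane $\mathbb{RP}^2$; the space of $n$-configurations carries its natural topology. A configuration is simple if no three of its points are collinear, and typical if it is simple and no six of its points lie on a common conic. An L-deformation (resp. Q-deformation) is a continuous path $\mathcal P_t$, $t\in[0,1]$, in the space of simple (resp. typical) $n$-configurations. For a simple $n$-configuration $\mathcal P$, its adjacency graph $\Gamma_{\mathcal P}$ has vertex set $\mathcal P$, and $p,q\in\mathcal P$ are joined by an edge iff at least one of the two segments of the line $pq$ with endpoints $p,q$ meets none of the lines passing through two points of $\mathcal P\smallsetminus\{p,q\}$. For a simple $6$-configuration the number of connected components of $\Gamma_{\mathcal P}$ is one of $1,2,3,6$. For a simple $7$-configuration $\mathcal P$ and $p\in\mathcal P$, let $\delta(p)\in\{1,2,3,6\}$ be the number of connected components of $\Gamma_{\mathcal P\smallsetminus\{p\}}$; the derivative code of $\mathcal P$ is $\sigma=(\sigma_1,\sigma_2,\sigma_3,\sigma_6)$, where $\sigma_k$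 is the number of points $p\in\mathcal P$ with $\delta(p)=k$. It is known (from earlier work) that every simple $7$-configuration has one of the eleven codes $(7,0,0,0)$, $(3,4,0,0)$, $(2,2,3,0)$, $(1,2,2,2)$, $(1,0,6,0)$, $(1,6,0,0)$, $(1,4,2,0)$, $(1,2,4,0)$, $(0,4,3,0)$, $(0,6,1,0)$, $(0,3,3,1)$, and that for each such $\sigma$ the set of simple $7$-configurations with code $\sigma$ is exactly one L-deformation class. *)

(* Defs.v *)
From HB Require Import structures.
From mathcomp Require Import all_boot all_order fingroup perm all_algebra.
From mathcomp Require Import all_classical all_reals all_analysis.

Set Implicit Arguments.
Unset Strict Implicit.
Unset Printing Implicit Defensive.

Import Order.TTheory GRing.Theory Num.Theory.
Import numFieldNormedType.Exports.
Local Open Scope ring_scope.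

Section Configurations.
Variable R : realType.

(* A point of RP^2 is represented by a nonzero vector of R^3 (homogeneous
   coordinates); two vectors represent the same point iff proportional. *)
Definition pt := 'rV[R]_3.

Definition coord (x : pt) (k : nat) : R := x ord0 (inord k).

Definition proj_eq (u w : pt) : Prop := exists k : R, k != 0 /\ u = k *: w.

Definition det3 (u v w : pt) : R :=
  \det (\matrix_(i < 3, j < 3)
          (if (i : nat) == 0%N then u ord0 j
           else if (i : nat) == 1%N then v ord0 j else w ord0 j)).

(* A 7-configuration, represented by an (ordered) choice of representatives
   of its 7 points. *)
Definition config := 'I_7 -> pt.

Definition simple_config (f : config) : Prop :=
  [/\ forall i, f i != 0,
      forall i j, i != j -> ~ proj_eq (f i) (f j)
    & forall i j k, i != j -> j != k -> i != k -> det3 (f i) (f j) (f k) != 0].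

Definition conic_val (a b c d e g : R) (x : pt) : R :=
  a * coord x 0 ^+ 2 + b * coord x 1 ^+ 2 + c * coord x 2 ^+ 2
  + d * coord x 0 * coord x 1 + e * coord x 0 * coord x 2
  + g * coord x 1 * coord x 2.

Definition on_common_conic (f : config) (S : {set 'I_7}) : Prop :=
  exists a b c d e g : R,
    [|| a != 0, b != 0, c != 0, d != 0, e != 0 | g != 0] /\
    forall i, i \in S -> conic_val a b c d e g (f i) = 0.

Definition typical (f : config) : Prop :=
  simple_config f /\
  forall S : {set 'I_7}, #|S| = 6%N -> ~ on_common_conic f S.

(* The segment of the line pq with endpoints p, q given by the sign sg
   (sg = 1 or sg = -1), i.e. {[a p + sg b q] | a, b >= 0, (a,b) <> 0},
   meets the line through r and s. *)
Definition seg_meets_line (p q r s : pt) (sg : R) : Prop :=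
  exists a b : R, [/\ 0 <= a, 0 <= b, (a != 0) || (b != 0)
                   & det3 r s (a *: p + (sg * b) *: q) = 0].

Definition adj_rel (f : config) (A : {set 'I_7}) : rel 'I_7 :=
  fun i j => `[< [/\ i \in A, j \in A, i != j &
     exists sg : R, (sg = 1 \/ sg = -1) /\
       forall r s, r \in A -> s \in A -> r != s ->
         r \notin [set i; j] -> s \notin [set i; j] ->
         ~ seg_meets_line (f i) (f j) (f r) (f s) sg] >].

Definition ncomp_adj (f : config) (A : {set 'I_7}) : nat :=
  n_comp (adj_rel f A) (mem A).

Definition delta (f : config) (p : 'I_7) : nat := ncomp_adj f [set~ p].

Definition deriv_code (f : config) : nat * nat * nat * nat :=
  (#|[set p | delta f p == 1%N]|, #|[set p | delta f p == 2%N]|,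
   #|[set p | delta f p == 3%N]|, #|[set p | delta f p == 6%N]|).

Definition QC (sg : nat * nat * nat * nat) (f : config) : Prop :=
  typical f /\ deriv_code f = sg.

Definition same_config (f g : config) : Prop :=
  exists s : 'S_7, forall i, proj_eq (f i) (g (s i)).

Definition path_in (P : config -> Prop) (f g : config) : Prop :=
  exists v : 'I_7 -> R -> 'rV[R]_3,
    [/\ forall i, {within [set t : R | 0 <= t <= 1], continuous (v i)}%classic,
        forall t : R, 0 <= t <= 1 -> P (fun i => v i t),
        same_config (fun i => v i 0) f
      & same_config (fun i => v i 1) g].

Definition n_path_components (P : config -> Prop) (n : nat) : Prop :=
  exists reps : 'I_n -> config,
    [/\ forall k, P (reps k),
        forall k l, k != l -> ~ path_in P (reps k) (reps l)
      & forall g, P g -> exists k, path_in P g (reps k)].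

End Configurations.

(* Main.v *)
(** A typical configuration is studied through 42 signs: those of the determinants of
    its 35 triples of points and of the seven brackets [con] telling whether six
    points lie on a conic. The three-term relations among them (Grassmann-Pluecker
    relations, the expression of [con] through the determinants, and the pencils of
    conics through four points) leave, up to relabelling and reorientation, only
    fourteen sign vectors; this is found by adding the points one at a time. All
    fourteen arise from a single sign vector [s0] by relabelling and applying the
    quadratic transformation based at three points of the configuration, which acts
    on sign vectors and on paths. So it is enough to realize [s0] and to connect any
    two of its realizations: there each of the last four points can be moved freely
    in a triangle cut out by three lines through earlier points, the other signs
    being forced by the relations, and the first three points form a frame.
    Conversely, signs are constant along paths, they determine the derivative code,
    and classes with equal codes are told apart by trying all relabellings. *)

From Stdlib Require Import BinNums BinNat.
From HB Require Import structures.
From mathcomp Require Import all_boot all_order fingroup perm all_algebra.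
From mathcomp Require Import all_classical all_reals all_analysis ring lra.
Require Import Defs.

Set Implicit Arguments.
Unset Strict Implicit.
Unset Printing Implicit Defensive.

Import Order.TTheory GRing.Theory Num.Theory.
Import numFieldNormedType.Exports.

(** * Sign vectors *)

(** A sign vector satisfying the relations need not be realizable, and its realizations need not
    form a connected set: in a general class the last point ranges over a region bounded by lines
    and conics that is awkward to parametrize. The quadratic transformation settles both questions
    for all classes but one, since it exchanges a line through three further points with the conic
    through these and the base points, and so puts the 42 brackets on an equal footing. In the
    background is the root system E7: its 63 positive roots are the 35 triples, the 7 sextuples and
    the 21 pairs of points, and the relabellings generate its Weyl group together with the quadratic
    transformation. The enumeration uses only that the relations are sound: the true sign vector is
    never discarded, and what survives is realized afterwards. A further difficulty is that points
    are vectors up to scalars, whereas signs and the quadratic transformation depend on the vectors;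
    hence the reorientations in the computations and the care for representatives along paths. *)

(* [None] is the sign of zero, [Some true] that of the negative numbers. *)
Definition sgn := option bool.
Definition mulo (a b : sgn) : sgn :=
  if a is Some x then if b is Some y then Some (x (+) y) else None else None.
Definition sgo (b : bool) (a : sgn) : sgn := if a is Some x then Some (b (+) x) else None.

(* Three points stand for their determinant, six points for the bracket [con]
   defined below. *)
Definition bracket := seq nat.

Definition triples k : seq bracket :=
  [seq [:: i; j; k] | i <- iota 0 k, j <- iota i.+1 (k - i.+1)].
Definition six o : bracket := [seq i <- iota 0 7 | i != o].

(* The first [nvars n] brackets are the ones involving the first [n] points only. *)
Definition vars : seq bracket :=
  triples 2 ++ triples 3 ++ triples 4 ++ triples 5 ++ six 6
  :: triples 6 ++ [seq six o | o <- iota 0 6].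
Definition nvars n := nth 0 [:: 0; 0; 0; 1; 4; 10; 21; 42] n.

Fixpoint ins x (l : seq nat) : bool * seq nat :=
  if l is y :: l' then
    if x <= y then (false, x :: l) else let: (b, m) := ins x l' in (~~ b, y :: m)
  else (false, [:: x]).

(* The boolean is the parity of the sorting permutation. *)
Fixpoint srt (l : seq nat) : bool * seq nat :=
  if l is x :: l' then
    let: (b, m) := srt l' in let: (c, k) := ins x m in (b (+) c, k)
  else (false, [::]).

(** Brackets alternate, so any order of the points is read from the sorted one. A bracket absent
    from [vars], or beyond the end of a partial vector, reads as [None]. *)
Definition lk (s : seq sgn) (l : bracket) : sgn :=
  let: (b, m) := srt l in sgo b (nth None s (index m vars)).

Definition term := (bool * seq bracket)%type.

Definition tsgn (s : seq sgn) (t : term) : sgn :=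
  sgo t.1 (foldr (fun l => mulo (lk s l)) (Some false) t.2).

(** The condition on the signs under which real numbers can add up to zero. *)
Definition zero_sum (ts : seq sgn) : bool :=
  all (pred1 None) ts || ((Some false \in ts) && (Some true \in ts)).

Definition plucker_rel x a b c d : seq term :=
  [:: (false, [:: [:: x; a; b]; [:: x; c; d]]); (true, [:: [:: x; a; c]; [:: x; b; d]]);
      (false, [:: [:: x; a; d]; [:: x; b; c]])].

Definition con_rel a b c d e f : seq term :=
  [:: (false, [:: [:: a; b; e]; [:: c; d; e]; [:: a; c; f]; [:: b; d; f]]);
      (true, [:: [:: a; b; f]; [:: c; d; f]; [:: a; c; e]; [:: b; d; e]]);
      (true, [:: [:: a; b; c; d; e; f]])].

Definition pencil_rel a b c d e f g : seq term :=
  [:: (false, [:: [:: a; b; e]; [:: c; d; e]; [:: a; b; c; d; f; g]]);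
      (false, [:: [:: a; b; f]; [:: c; d; f]; [:: a; b; c; d; g; e]]);
      (false, [:: [:: a; b; g]; [:: c; d; g]; [:: a; b; c; d; e; f]])].

Fixpoint combs k (l : seq nat) : seq (seq nat) :=
  if k is k'.+1 then
    (fix go l := if l is x :: l' then [seq x :: c | c <- combs k' l'] ++ go l' else [::]) l
  else [:: [::]].

Definition without (c : seq nat) (l : seq nat) := [seq i <- l | i \notin c].

Definition pts := iota 0 7.

Definition plucker_rels : seq (seq term) :=
  [seq plucker_rel x (nth 0 c 0) (nth 0 c 1) (nth 0 c 2) (nth 0 c 3)
    | x <- pts, c <- combs 4 (without [:: x] pts)].

(* The three ways to arrange four points into the two line pairs of [con_rel] and
   [pencil_rel]. *)
Definition pairings (q : seq nat) : seq (seq nat) :=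
  if q is [:: a; b; c; d] then [:: q; [:: a; c; d; b]; [:: a; d; b; c]] else [::].

(** The two products in [con_rel] are the two sets of alternate faces of the octahedron with
    opposite vertices [e f], [a d] and [b c]. So a sextuple has one expression for each of its
    fifteen perfect matchings, and all are obtained with [e] its first point. *)
Definition con_rels : seq (seq term) :=
  flatten [seq let l := six o in let e := nth 0 l 0 in
      [seq con_rel (nth 0 q 0) (nth 0 q 1) (nth 0 q 2) (nth 0 q 3) e f
        | f <- behead l, q <- pairings (without [:: e; f] l)]
    | o <- pts].

Definition pencil_rels : seq (seq term) :=
  [seq pencil_rel (nth 0 q 0) (nth 0 q 1) (nth 0 q 2) (nth 0 q 3)
      (nth 0 efg 0) (nth 0 efg 1) (nth 0 efg 2)
    | efg <- combs 3 pts, q <- pairings (without efg pts)].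

Definition rels := plucker_rels ++ con_rels ++ pencil_rels.

(* Relations with sorted brackets, given by their positions in [vars]. *)
Definition cterm := (bool * seq nat)%type.

Definition compile (t : term) : cterm :=
  foldr (fun l u => let: (b, m) := srt l in (b (+) u.1, index m vars :: u.2))
    (t.1, [::]) t.2.

Definition ctsgn (s : seq sgn) (t : cterm) : sgn :=
  sgo t.1 (foldr (fun i => mulo (nth None s i)) (Some false) t.2).

Definition crels : seq (seq cterm) := [seq [seq compile t | t <- r] | r <- rels].

Definition last_var (r : seq cterm) : nat :=
  foldr (fun t m => foldr maxn m t.2) 0 r.

Definition consistent (rs : seq (seq cterm)) (s : seq sgn) : bool :=
  all (fun r => zero_sum [seq ctsgn s t | t <- r]) rs.

(** [cs] lists the signs allowed at the positions from [n] on. A relation is tested as soon as its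
    last bracket is assigned, which keeps the search small. *)
Fixpoint extend (cs : seq (seq sgn)) n (L : seq (seq sgn)) : seq (seq sgn) :=
  if cs is c :: cs' then
    let rs := [seq r <- crels | last_var r == n] in
    extend cs' n.+1 [seq q <- [seq rcons p x | p <- L, x <- c] | consistent rs q]
  else L.

Definition act (p : seq nat) (s : seq sgn) : seq sgn :=
  [seq lk s [seq nth i p i | i <- l] | l <- take (size s) vars].

(** Only triples are affected: the bracket of six points has degree two in each of them. *)
Definition reor (e : nat -> bool) (s : seq sgn) : seq sgn :=
  [seq sgo ((size x.1 == 3) && foldr (fun i b => e i (+) b) false x.1) x.2 | x <- zip vars s].

Definition lkb s l : bool := odflt false (lk s l).

(* The reorientation making the brackets of the points 0, 1, 2, 3 and all the
   brackets [0 1 k] positive. *)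
Definition eps (s : seq sgn) (i : nat) : bool :=
  let b i j k := lkb s [:: i; j; k] in
  let p := b 0 1 2 (+) b 0 1 3 (+) b 0 2 3 (+) b 1 2 3 in
  let e0 := p (+) b 1 2 3 in let e1 := p (+) b 0 2 3 in
  nth (e0 (+) e1 (+) b 0 1 i) [:: e0; e1; p (+) b 0 1 3; p (+) b 0 1 2] i.

Definition norm (s : seq sgn) : seq sgn :=
  let e := [seq eps s i | i <- pts] in reor (nth false e) s.

(** The monomial giving the sign of the bracket [l] after the quadratic transformation based at the
    points 0, 1, 2. It is read off the formulas for [quad], without the even powers of [[0 1 2]];
    [k i x] is that determinant with [x] in the place of [i]. *)
Definition crt (l : bracket) : term :=
  let k i x := nth [::] [:: [:: x; 1; 2]; [:: 0; x; 2]; [:: 0; 1; x]] i in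
  let lo := [seq i <- l | i < 3] in let hi := [seq i <- l | 3 <= i] in
  let ks := [seq k i x | i <- lo, x <- hi] in
  if size l == 3 then
    match size lo with
    | 3 => (false, [:: [:: 0; 1; 2]])
    | 2 => (1 \notin lo, [:: 0; 1; 2] :: ks)
    | 1 => (true, l :: ks)
    | _ => (false, [:: [:: 0; 1; 2]; [:: 0, 1, 2 & hi]])
    end
  else if size lo == 3 then (false, hi :: ks) else (false, l :: ks).

Definition crs (s : seq sgn) : seq sgn := [seq tsgn s (crt l) | l <- vars].

(** The signs of the integer points [base_points], in a class where the triangles of [steps_ok]
    exist. *)
Definition s0 : seq sgn :=
  let neg := [:: [:: 0; 3; 6]; [:: 0; 4; 6]; [:: 0; 5; 6]; [:: 1; 2; 5]; [:: 1; 2; 6];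
    [:: 1; 3; 5]; [:: 1; 3; 6]; [:: 1; 4; 5]; [:: 1; 4; 6]; [:: 1; 5; 6]; [:: 2; 3; 4];
    [:: 2; 3; 5]; [:: 2; 3; 6]; [:: 2; 4; 5]; [:: 2; 4; 6]; [:: 2; 5; 6]; [:: 3; 4; 5];
    [:: 3; 4; 6]; [:: 3; 5; 6]; [:: 4; 5; 6]; six 0; six 1; six 2; six 3; six 4] in
  [seq Some (l \in neg) | l <- vars].

(* The entry [(j, p)] says that the next class is obtained from the [j]-th one by
   relabelling along [p] and then applying the quadratic transformation. *)
Definition tree : seq (nat * seq nat) :=
  [:: (0, [:: 0; 1; 3; 2; 4; 5; 6]); (0, [:: 0; 1; 5; 2; 3; 4; 6]);
      (0, [:: 0; 2; 3; 1; 4; 5; 6]); (0, [:: 0; 3; 4; 1; 2; 5; 6]);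
      (0, [:: 0; 3; 6; 1; 2; 4; 5]); (0, [:: 0; 4; 5; 1; 2; 3; 6]);
      (0, [:: 1; 3; 6; 0; 2; 4; 5]); (1, [:: 0; 4; 5; 1; 2; 3; 6]);
      (1, [:: 0; 5; 6; 1; 2; 3; 4]); (1, [:: 2; 3; 4; 0; 1; 5; 6]);
      (1, [:: 2; 3; 6; 0; 1; 4; 5]); (1, [:: 2; 4; 6; 0; 1; 3; 5]);
      (4, [:: 3; 4; 5; 0; 1; 2; 6])].

Definition classes : seq (seq sgn) :=
  foldl (fun cs jp => rcons cs (crs (act jp.2 (nth [::] cs jp.1)))) [:: s0] tree.

Definition pos : sgn := Some false.
Definition nonzero : seq sgn := [:: Some false; Some true].

(* Replacing the new point by its opposite makes its bracket with 0 and 1 positive. *)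
Definition leaves n (L : seq (seq sgn)) : seq (seq sgn) :=
  extend ([:: pos] :: nseq (nvars n.+1 - nvars n).-1 nonzero) (nvars n) L.

(** The number of digits is prescribed so that a leading label 0 is not lost. *)
Definition digits k (x : N) : seq nat :=
  (fix go k x acc := if k is k'.+1 then
      let: (q, r) := N.div_eucl x 10 in go k' q (nat_of_bin r :: acc)
    else acc) k x [::].

(* The one-point extensions of [L] lie in [L'] up to reorientation, once relabelled
   as [wit] tells. *)
Definition reduces n (L : seq (seq sgn)) (wit : seq N) (L' : seq (seq sgn)) : bool :=
  let M := leaves n L in
  (size M == size wit) && all (fun x => let p := digits n.+1 x.2 in
     [&& perm_eq p (iota 0 n.+1), None \notin act p x.1 & norm (act p x.1) \in L'])
     (zip M wit).

(** Only the brackets in [lines] are imposed; the other new ones may even be zero. So the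
    computation also shows that none of them can vanish while the new point moves. *)
Definition forced n (lines : seq bracket) : bool :=
  extend [seq if nth [::] vars i \in lines then [:: nth None s0 i]
              else None :: nonzero | i <- iota (nvars n) (nvars n.+1 - nvars n)]
    (nvars n) [:: take (nvars n) s0] == [:: take (nvars n.+1) s0].

(** A line through two other points meets exactly one of the two segments from [i] to [j], and the
    product of its signs at [i] and [j] tells which. One of the segments is free iff all these
    products agree; other representatives flip all of them or none. *)
Definition adjS (s : seq sgn) (A : seq nat) i j : bool :=
  if [&& i \in A, j \in A & i != j] then
    let vs := [seq mulo (lk s (rt ++ [:: i])) (lk s (rt ++ [:: j]))
                | rt <- combs 2 (without [:: i; j] A)] in
    all (pred1 (Some false)) vs || all (pred1 (Some true)) vs
  else false.

(* Each round replaces the label of a point by the least label around it, so that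
   in the end the labels are the least points of the components. *)
Definition labels s A : seq nat :=
  let nb := [seq [seq j <- pts | adjS s A i j] | i <- pts] in
  iter 6 (fun c => [seq foldr minn (nth 0 c i) [seq nth 0 c j | j <- nth [::] nb i] | i <- pts])
    pts.

Definition deltaS s o : nat :=
  let A := without [:: o] pts in let c := labels s A in count (fun i => nth 0 c i == i) A.
Definition codeS s : nat * nat * nat * nat :=
  let d := [seq deltaS s o | o <- pts] in
  (count_mem 1 d, count_mem 2 d, count_mem 3 d, count_mem 6 d).

(* In base ten, for each of the [leaves], a relabelling that brings it to one of the
   chosen representatives. *)
Definition wit3 : seq N := [:: 12]%num.
Definition wit4 : seq N := [:: 123; 123; 123; 123]%num.
Definition wit5 : seq N :=
  [:: 1432; 1234; 2341; 3412; 2431; 1243; 1342; 3421; 2413; 2314; 1324; 1423]%num.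

Definition wit6 : seq N := [::
    12345; 12345; 15432; 12345; 105432; 201543; 152043; 320514; 324105; 201453; 102354;
    104532; 12354; 14532; 12354; 21453; 12345; 53214; 21435; 21435; 14352; 12534;
    104352; 102534; 102534; 410523; 203415; 25143; 140235; 203415; 203415; 104325;
    104325; 105234; 104325; 15234]%num.

Definition wit7 : seq N := [::
    3652104; 5216304; 1450362; 3014562; 5361240; 3520641; 326541; 1245063; 5061432;
    631452; 1254063; 4125360; 123654; 4361250; 543612; 2365410; 2541360; 5412063;
    5421063; 1065234; 635214; 346125; 1365420; 3140625; 3614502; 1456302; 5210364;
    3052164; 2356410; 643512; 531462; 6051432; 1246053; 325641; 3620541; 6351240;
    3014652; 1460352; 6215304; 3562104; 1652340; 3602145; 4362105; 2514360; 5064123;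
    3410625; 465231; 6524031; 2163045; 321645; 6042513; 653412; 2301456; 6031542;
    6043512; 2350416; 351642; 5160342; 4610253; 643251; 6304251; 1034526; 453612;
    4062513; 246153; 6024351; 1023546; 6350241; 321465; 2143065; 4526031; 645231;
    3610425; 5046123; 2516340; 6342105; 3402165; 1452360; 3042615; 1623540; 4263015;
    1364520; 3516240; 6351042; 315624; 1560324; 2650413; 426513; 623415; 6042315;
    6302415; 5032146; 213654; 2064153; 5043126; 6310425; 345261; 4523061; 2146035;
    621435; 3650241; 1026543; 3024651; 4156320; 6324501; 3204561; 5643120; 2463051;
    3156420; 3012654; 3650124; 6315024; 4316250; 623154; 135264; 6015234; 5426013;
    341625; 3640125; 6315420; 2410536; 3052614; 5260314; 6451302; 3164502; 3604521;
    2364501; 4152360; 1062543; 3250641; 261435; 6142035; 4563021; 345621; 6024153;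
    613254; 4305216; 6035124; 6023154; 4310256; 2614350; 4352106; 3502146; 1562340;
    2641305; 1302456; 3052416; 643125; 3120456; 1250436; 634125; 1250463; 631425;
    4063521; 2534160; 6354021; 4215630; 3425610; 5063421; 2514306; 2456130; 4625130;
    265314; 2536401; 5241306; 3152640; 512463; 3562140; 4352160; 2014356; 2641350;
    2614305; 1264053; 531426; 1260453; 534126; 1260435; 3120465; 543126; 3062415;
    1302465; 2541306; 3402615; 5042163; 214356; 2036154; 5260341; 1620435; 213456;
    2041356; 2643150; 356142; 4261503; 6401253; 5041362; 514362; 6154203; 456312;
    1420635; 5240361; 264153; 4150632; 1530642; 4035612; 1405632; 5261403; 4605312;
    2065134; 516423; 5043126; 2034156; 216354; 5062143; 3602415; 2561304; 1302645;
    3042615; 563124; 3120645; 1240635; 1350642; 2530461; 326415; 6123504; 213465;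
    6301524; 2031465; 3561204; 3562104; 426135; 5031426; 514326; 2560431; 1650342;
    5046123; 513426; 2035164; 4305612; 5231406; 1405362; 4065312; 1560342; 4150362;
    234156; 243156; 1560324; 241356; 1563024; 5613402; 5631420; 5013426; 3425160;
    4265130; 215364; 4125630; 5246301; 2531406; 562413; 3652140; 2534106; 5213406;
    2064351; 4352610; 3512640; 6423051; 5243160; 641352; 1520364; 3064251; 643152;
    634152; 4150326; 1520346; 1265430; 4025316; 1405326; 5631402; 4205136; 3425106;
    5613420; 2153046; 5624031; 456231; 214365; 2046135; 6241503; 1506432; 5410362;
    6214530; 4536102; 5236104; 3612504; 1430526; 1436052; 4105362; 2650314; 6231504;
    4013526; 2563041; 5204631; 6205431; 542631; 6421053; 5641023; 6241503; 621543;
    6450231; 5024631; 1056234; 6421053; 4526130; 5412360; 642531; 4103526; 5206431;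
    123564; 4216530; 4153206; 6204531; 1340526; 2653041; 5231604; 2560314; 4106352;
    1435062; 3512604; 6235104; 5214630; 5241603; 5614320; 6124350; 1456230; 4156203;
    1425603; 2106453; 421653; 2036154; 6412035; 215364; 4316250; 4126350; 3421560;
    3106452; 641352; 4205316; 4235106; 1635042; 6104352; 2540316; 2453061; 3152604;
    1360524; 4206531; 5321604; 6153204; 3124650; 3624510; 6214530; 2436150; 1240653;
    3142605; 4236105; 1206435; 412635; 1235046; 436152; 3614052; 124563; 1046253;
    6142305; 2306451; 3420561; 6124350; 4356201; 3156204; 5621304; 2450316; 4203561;
    1630524; 6152304; 4025316; 2456031; 3104652; 1365042; 341652; 6103452; 3642015;
    6412035; 612345; 6142305; 3014652; 6430152; 2513046; 4063521; 1236504; 2150364;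
    4605312; 6431052; 452631; 1205436; 1426053; 3245061; 1246503; 1526403; 3241065;
    2430156; 1450236; 5142063; 2316405; 2146305; 5143062; 2416035; 2103456; 1325046;
    6452031; 431652; 4065312; 2156304; 1230564; 4603521; 1354620; 4253016; 1523640;
    2031456; 5301624; 213456; 5123604; 3510624; 2150436; 1205436; 3025614; 534621;
    4235106; 325641; 352614; 1532406; 3052641; 4502136; 231654; 3240651; 5420136;
    2304651; 5034126; 2435601; 543126; 2453601; 1523046; 4253610; 5132640; 4312056;
    1532604; 352416; 1523604; 3025416; 1205634; 2150634; 3510426; 5123406; 213654;
    5301426; 2031654; 325614; 124635; 4103526; 2013645; 4321506; 231645; 2340615;
    1430526; 3204615; 1024536; 3412605; 142536; 2340651; 4312650; 5132046; 3421056;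
    5241630; 1250634; 451326; 2541603; 4015326; 2105643; 1250643; 4520316; 213645;
    1042653; 5402316; 124653; 5214306; 142635; 3412506; 1024635; 3204516; 415623;
    1430625; 2340516; 231546; 4321605; 2013546; 4103625; 5241036; 3421650; 1430652;
    2514630; 3154026; 2453610; 5214603; 124356; 5402613; 1042356; 4520613; 1250346;
    2105346; 4015623; 2541306; 451623; 142653; 543612; 3145206; 415632; 3501246;
    4051632; 4130652; 5310246; 1345602; 5043216; 1403652; 3154620; 2514036; 1354602;
    534216; 1345026; 2435610; 325146; 4235601; 2541630; 4502631; 3052146; 5420631;
    3240156; 451632; 5034621; 2304156; 534612; 1354206; 2453106; 543621; 1403256;
    5043612; 352641; 5310642; 4130256; 1532640; 4051236; 3501642; 2435016; 1345620;
    415236; 3145602]%num.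

Definition classes5 := [:: take 10 s0].
(** Four of the thirty-six leaves represent them all up to relabelling and reorientation, as
    [reduces5] checks. *)
Definition classes6 := let L := leaves 5 classes5 in [seq nth [::] L i | i <- [:: 0; 1; 3; 16]].

(** Certifies that six rounds have been enough. Labels are reachable by construction; it remains to
    see that they lie in [A], label themselves and are constant along edges. *)
Definition labels_ok (s : seq sgn) (A : seq nat) : bool :=
  let c := labels s A in
  all (fun i => let ci := nth 0 c i in
    [&& ci \in A, nth 0 c ci == ci & all (fun j => if adjS s A i j then
          (nth 0 c j == ci) && adjS s A j i else true) A]) A.

Definition codes_ok (s : seq sgn) : bool :=
  all (fun i => labels_ok s (without [:: i] pts)) pts.

Opaque vars crels.

Local Open Scope ring_scope.

(** * Brackets, conics and the quadratic transformation *)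

Section Brackets.
Variable R : realType.
Implicit Types a b c d e f g p q x y z u w : pt R.

Local Notation "[ a b c ]" := (det3 a b c)
  (a at level 8, b at level 8, c at level 8, format "[ a  b  c ]").

Lemma det3E a b c : [a b c] =
  coord a 0 * (coord b 1 * coord c 2 - coord b 2 * coord c 1)
  - coord a 1 * (coord b 0 * coord c 2 - coord b 2 * coord c 0)
  + coord a 2 * (coord b 0 * coord c 1 - coord b 1 * coord c 0).
Proof.
rewrite /det3 (expand_det_row _ ord0) !big_ord_recl big_ord0 /cofactor.
rewrite !(expand_det_row _ ord0) !big_ord_recl !big_ord0 /cofactor !det_mx11.
rewrite !mxE /= /bump /= !add0n /coord.
have E (u : pt R) (i : 'I_3) : u ord0 i = u ord0 (inord i) by rewrite inord_val.
rewrite !(E _ (lift _ _)) /= !(E _ ord0) /= /bump /=.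
rewrite !(expr0, expr1, sqrrN, expr1n, expr2) /=. ring.
Qed.

Lemma coordD x y k : coord (x + y) k = coord x k + coord y k.
Proof. by rewrite /coord mxE. Qed.

Lemma coordZ r x k : coord (r *: x) k = r * coord x k.
Proof. by rewrite /coord mxE. Qed.

Lemma pt_ext x y : coord x 0 = coord y 0 -> coord x 1 = coord y 1 ->
  coord x 2 = coord y 2 -> x = y.
Proof.
move=> e0 e1 e2; apply/rowP => -[[|[|[|//]]] lti].
- by move: e0; rewrite /coord (_ : inord 0 = Ordinal lti) //; apply/val_inj; rewrite /= inordK.
- by move: e1; rewrite /coord (_ : inord 1 = Ordinal lti) //; apply/val_inj; rewrite /= inordK.
- by move: e2; rewrite /coord (_ : inord 2 = Ordinal lti) //; apply/val_inj; rewrite /= inordK.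
Qed.

Lemma det3_swap12 a b c : [b a c] = - [a b c].
Proof. by rewrite !det3E; ring. Qed.

Lemma det3_swap23 a b c : [a c b] = - [a b c].
Proof. by rewrite !det3E; ring. Qed.

Lemma det3_rot a b c : [b c a] = [a b c].
Proof. by rewrite !det3E; ring. Qed.

Lemma det3Z r s t a b c : [(r *: a) (s *: b) (t *: c)] = r * s * t * [a b c].
Proof. by rewrite !det3E !coordZ; ring. Qed.

Lemma det3D a b x y : [a b (x + y)] = [a b x] + [a b y].
Proof. by rewrite !det3E !coordD; ring. Qed.

Lemma det3Zr a b r x : [a b (r *: x)] = r * [a b x].
Proof. by rewrite !det3E !coordZ; ring. Qed.

Lemma det3aa a b : [a a b] = 0.
Proof. by rewrite !det3E; ring. Qed.

Lemma det3bb a b : [a b b] = 0.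
Proof. by rewrite !det3E; ring. Qed.

Lemma det3aba a b : [a b a] = 0.
Proof. by rewrite !det3E; ring. Qed.

Lemma det3_cramer a b c x :
  [a b c] *: x = [x b c] *: a + [a x c] *: b + [a b x] *: c.
Proof.
by apply: pt_ext; rewrite !coordD !coordZ !det3E; ring.
Qed.

Lemma plucker x a b c d :
  [x a b] * [x c d] - [x a c] * [x b d] + [x a d] * [x b c] = 0.
Proof. by rewrite !det3E; ring. Qed.

(* It vanishes iff the six points lie on a conic: the pencil of conics through
   [a, b, c, d] is spanned by the line pairs [ab|cd] and [ac|bd], and [con] compares
   its member through [e] with the one through [f]. *)
Definition con a b c d e f : R :=
  [a b e] * [c d e] * ([a c f] * [b d f]) - [a b f] * [c d f] * ([a c e] * [b d e]).

Let eq_lin2 (r s u v p q : R) : p = 0 -> q = 0 -> r - s = u * p + v * q -> r = s.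
Proof. by move=> -> ->; rewrite !mulr0 addr0 => /eqP; rewrite subr_eq0 => /eqP. Qed.

(** The swap keeps the line pair [ab|cd] and replaces [ac|bd] by [ad|bc], which the relations at [e]
    and [f] express through the other two. The five adjacent swaps together make [con] alternating,
    so that sorted brackets suffice. *)
Lemma con_swap12 a b c d e f : con b a c d e f = - con a b c d e f.
Proof.
have Pe := plucker e a b c d; have Pf := plucker f a b c d.
rewrite /con !(det3_rot e, det3_rot f) (det3_swap23 e a b) (det3_swap23 f a b).
apply: (eq_lin2 (u := - ([e a b] * [e c d])) (v := [f a b] * [f c d]) Pf Pe).
by ring.
Qed.

Lemma con_swap23 a b c d e f : con a c b d e f = - con a b c d e f.
Proof. by rewrite /con; ring. Qed.

Lemma con_swap34 a b c d e f : con a b d c e f = - con a b c d e f.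
Proof.
have Pe := plucker e a b c d; have Pf := plucker f a b c d.
rewrite /con !(det3_rot e, det3_rot f) (det3_swap23 e c d) (det3_swap23 f c d).
apply: (eq_lin2 (u := - ([e a b] * [e c d])) (v := [f a b] * [f c d]) Pf Pe).
by ring.
Qed.

(** Regrouped into the factors through [b] and those through [c], the bracket compares the
    cross-ratios of [a, d, e, f] seen from these two points (Steiner). The swap then is a linear
    change in both pencils of lines. *)
Lemma con_swap45 a b c d e f : con a b c e d f = - con a b c d e f.
Proof.
have Pb := plucker b a d e f; have Pc := plucker c a d e f.
rewrite /con (det3_swap23 c d e) (det3_swap23 b d e).
rewrite !(det3_swap12 b a) !(det3_swap12 c a).
apply: (eq_lin2 (u := - ([c d e] * [c a f])) (v := [b a f] * [b d e]) Pb Pc).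
by ring.
Qed.

Lemma con_swap56 a b c d e f : con a b c d f e = - con a b c d e f.
Proof. by rewrite /con; ring. Qed.

(** The conic brackets are the minors of the two-row matrix of values of [ab|cd] and [ac|bd] at
    [e, f, g]; this is the expansion of a determinant with its first row repeated. *)
Lemma con_pencil a b c d e f g :
  [a b e] * [c d e] * con a b c d f g + [a b f] * [c d f] * con a b c d g e
  + [a b g] * [c d g] * con a b c d e f = 0.
Proof. by rewrite /con; ring. Qed.

Lemma conZ r1 r2 r3 r4 r5 r6 a b c d e f :
  con (r1 *: a) (r2 *: b) (r3 *: c) (r4 *: d) (r5 *: e) (r6 *: f) =
  (r1 * r2 * r3 * r4 * r5 * r6) ^+ 2 * con a b c d e f.
Proof. by rewrite /con !det3Z; ring. Qed.

(* The standard quadratic transformation [(X : Y : Z) -> (YZ : XZ : XY)] in the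
   frame [p, q, r]. *)
Definition quad p q r x : pt R :=
  ([p x r] * [p q x]) *: p + ([x q r] * [p q x]) *: q + ([x q r] * [p x r]) *: r.

Lemma det3_frame p q r (a1 a2 a3 b1 b2 b3 c1 c2 c3 : R) :
  [(a1 *: p + b1 *: q + c1 *: r) (a2 *: p + b2 *: q + c2 *: r)
   (a3 *: p + b3 *: q + c3 *: r)] =
  (a1 * (b2 * c3 - c2 * b3) - b1 * (a2 * c3 - c2 * a3)
   + c1 * (a2 * b3 - b2 * a3)) * [p q r].
Proof. by rewrite !det3E !coordD !coordZ; ring. Qed.

Lemma det3_frame2 p q r x y : [p q r] * [p x y] = [p x r] * [p q y] - [p q x] * [p y r].
Proof. by rewrite !det3E; ring. Qed.

(** Lines through one base point go to such lines, lines avoiding the base points are exchanged with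
    conics through all three, and conics through exactly two of them are preserved as a family.
    Hence each bracket becomes a monomial in brackets, here and in the next lemmas. *)
Lemma quad_det12 p q r x : [p q (quad p q r x)] = [p q r] * ([x q r] * [p x r]).
Proof.
by rewrite /quad !det3D !det3Zr det3aba det3bb !mulr0 !add0r mulrC.
Qed.

Lemma quad_det13 p q r x : [p r (quad p q r x)] = - ([p q r] * ([x q r] * [p q x])).
Proof.
by rewrite /quad !det3D !det3Zr det3aba det3bb (det3_swap23 p q r); ring.
Qed.

Lemma quad_det23 p q r x : [q r (quad p q r x)] = [p q r] * ([p x r] * [p q x]).
Proof.
by rewrite /quad !det3D !det3Zr det3aba det3bb (det3_rot p q r); ring.
Qed.

Lemma quad_det1 p q r x y : [p (quad p q r x) (quad p q r y)] =
  - ([p q r] ^+ 2 * ([x q r] * [y q r] * [p x y])).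
Proof.
have := det3_frame p q r 1 ([p x r] * [p q x]) ([p y r] * [p q y])
  0 ([x q r] * [p q x]) ([y q r] * [p q y]) 0 ([x q r] * [p x r]) ([y q r] * [p y r]).
rewrite scale1r !scale0r !addr0 => ->.
transitivity (- ([p q r] * ([x q r] * [y q r] * ([p q r] * [p x y])))); last by ring.
by rewrite (det3_frame2 p q r); ring.
Qed.

Lemma quad_rot p q r x : quad q r p x = quad p q r x.
Proof.
by apply: pt_ext; rewrite /quad !coordD !coordZ !det3E; ring.
Qed.

Lemma quad_det2 p q r x y : [q (quad p q r x) (quad p q r y)] =
  - ([p q r] ^+ 2 * ([p x r] * [p y r] * [q x y])).
Proof.
rewrite -!(quad_rot p) quad_det1 (det3_rot p q r).
by rewrite -(det3_rot p x r) -(det3_rot p y r).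
Qed.

Lemma quad_det3 p q r x y : [r (quad p q r x) (quad p q r y)] =
  - ([p q r] ^+ 2 * ([p q x] * [p q y] * [r x y])).
Proof.
rewrite -!(quad_rot p) quad_det2 (det3_rot p q r).
by rewrite (det3_rot p q x) (det3_rot p q y).
Qed.

Lemma quad_det0 p q r x y z : [(quad p q r x) (quad p q r y) (quad p q r z)] =
  [p q r] ^+ 3 * con p q r x y z.
Proof.
rewrite det3_frame.
have E1 u w : [p q r] * [r u w] = [u q r] * [p w r] - [w q r] * [p u r].
  by rewrite !det3E; ring.
have E2 u w : [p q r] * [q u w] = - ([u q r] * [p q w] - [w q r] * [p q u]).
  by rewrite !det3E; ring.
transitivity ([p q r] *
  ([p q y] * ([p q r] * [r x y]) * ([p r z] * ([p q r] * [q x z]))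
   - [p q z] * ([p q r] * [r x z]) * ([p r y] * ([p q r] * [q x y])))).
  by rewrite !E1 !E2 (det3_swap23 p z r) (det3_swap23 p y r); ring.
by rewrite /con; ring.
Qed.

(** The counterpart of [quad_det0], the transformation being an involution up to scalars. *)
Lemma quad_con0 p q r x y z :
  con p q r (quad p q r x) (quad p q r y) (quad p q r z) =
  [p q r] ^+ 6 * ([x q r] * [y q r] * [z q r] * ([p x r] * [p y r] * [p z r])
    * ([p q x] * [p q y] * [p q z])) * [x y z].
Proof.
have := (quad_det12 p q r y, quad_det12 p q r z, quad_det13 p q r y,
  quad_det13 p q r z, (quad_det3 p q r x y, quad_det3 p q r x z,
  quad_det2 p q r x y, quad_det2 p q r x z)).
rewrite /con; move: (quad _ _ _ x) (quad _ _ _ y) (quad _ _ _ z) => x' y' z' E.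
rewrite !E.
have : [r x y] * [q x z] = [r x z] * [q x y] - [x q r] * [x y z].
  by rewrite !det3E; ring.
set u := [r x y]; set v := [q x z] => P.
transitivity (- ([p q r] ^+ 6 * ([y q r] * [z q r] * ([p x r] * [p y r] * [p z r])
    * ([p q x] * [p q y] * [p q z])) * (u * v - [r x z] * [q x y]))); first by ring.
by rewrite P; ring.
Qed.

(** In this order of the points every determinant in [con] contains exactly one of [q] and [r], so
    that [quad_det2] and [quad_det3] apply to each factor. *)
Lemma quad_con1 p q r x y z w :
  con q (quad p q r x) (quad p q r y) r (quad p q r z) (quad p q r w) =
  [p q r] ^+ 8 * ([p x r] * [p y r] * [p z r] * [p w r] *
    ([p q x] * [p q y] * [p q z] * [p q w])) * con q x y r z w.
Proof.
have := (quad_det2 p q r x z, quad_det2 p q r x w, quad_det2 p q r y z,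
  quad_det2 p q r y w, (quad_det3 p q r x z, quad_det3 p q r x w,
  quad_det3 p q r y z, quad_det3 p q r y w)).
rewrite /con; move: (quad _ _ _ x) (quad _ _ _ y) (quad _ _ _ z) (quad _ _ _ w).
move=> x' y' z' w' E; rewrite !(det3_swap12 r) !E; ring.
Qed.

Let con_inner a b c d e f : con a d b c e f = con a b c d e f.
Proof. by rewrite con_swap23 con_swap34 opprK. Qed.

Lemma quad_con12 p q r x y z w :
  con q r (quad p q r x) (quad p q r y) (quad p q r z) (quad p q r w) =
  [p q r] ^+ 8 * ([p x r] * [p y r] * [p z r] * [p w r] *
    ([p q x] * [p q y] * [p q z] * [p q w])) * con q r x y z w.
Proof. by rewrite con_inner quad_con1 -(con_inner q x y r). Qed.

Lemma quad_con02 p q r x y z w :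
  con p r (quad p q r x) (quad p q r y) (quad p q r z) (quad p q r w) =
  [p q r] ^+ 8 * ([x q r] * [y q r] * [z q r] * [w q r] *
    ([p q x] * [p q y] * [p q z] * [p q w])) * con p r x y z w.
Proof.
have := quad_con12 q r p x y z w; rewrite !(quad_rot p q r) => E.
have E1 u : [q u p] = [p q u] by exact: det3_rot.
have E2 u : [q r u] = [u q r] by exact: det3_rot.
by rewrite con_swap12 E (con_swap12 p r) E2 !E1 !E2; ring.
Qed.

Lemma quad_con01 p q r x y z w :
  con p q (quad p q r x) (quad p q r y) (quad p q r z) (quad p q r w) =
  [p q r] ^+ 8 * ([x q r] * [y q r] * [z q r] * [w q r] *
    ([p x r] * [p y r] * [p z r] * [p w r])) * con p q x y z w.
Proof.
have := quad_con12 r p q x y z w; rewrite -!(quad_rot r p q) => E.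
have E1 u : [r u q] = [u q r] by rewrite -det3_rot.
have E2 u : [r p u] = [p u r] by exact: esym (det3_rot r p u).
by rewrite E E2 !E1 !E2.
Qed.

(** The factor is recorded because its sign decides whether representatives are reversed when the
    transformation is applied twice. *)
Lemma quad_quad p q r x : quad p q r (quad p q r x) =
  ([p q r] ^+ 3 * ([x q r] * [p x r] * [p q x])) *: x.
Proof.
have Dx := det3_cramer p q r x.
have := (quad_det12 p q r x, quad_det13 p q r x, quad_det23 p q r x).
move: (quad p q r x) => x' E; rewrite /quad.
rewrite -(det3_rot x' q r) (det3_swap23 p r x') !E !opprK.
rewrite (_ : _ ^+ 3 * _ = [p q r] ^+ 2 * ([x q r] * [p x r] * [p q x]) * [p q r]); last by ring.
rewrite -[RHS]scalerA Dx !scalerDr !scalerA.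
by congr (_ *: _ + _ *: _ + _ *: _); ring.
Qed.

Let kernel3 (a1 a2 a3 b1 b2 b3 c1 c2 c3 X Y Z : R) :
  a1 * (b2 * c3 - c2 * b3) - b1 * (a2 * c3 - c2 * a3) + c1 * (a2 * b3 - b2 * a3) != 0 ->
  a1 * X + b1 * Y + c1 * Z = 0 -> a2 * X + b2 * Y + c2 * Z = 0 ->
  a3 * X + b3 * Y + c3 * Z = 0 -> [/\ X = 0, Y = 0 & Z = 0].
Proof.
set M := (M in M != 0) => M0 e1 e2 e3.
have MX : M * X = (a1 * X + b1 * Y + c1 * Z) * (b2 * c3 - c2 * b3)
  - (a2 * X + b2 * Y + c2 * Z) * (b1 * c3 - c1 * b3)
  + (a3 * X + b3 * Y + c3 * Z) * (b1 * c2 - c1 * b2) by rewrite /M; ring.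
have MY : M * Y = - (a1 * X + b1 * Y + c1 * Z) * (a2 * c3 - c2 * a3)
  + (a2 * X + b2 * Y + c2 * Z) * (a1 * c3 - c1 * a3)
  - (a3 * X + b3 * Y + c3 * Z) * (a1 * c2 - c1 * a2) by rewrite /M; ring.
have MZ : M * Z = (a1 * X + b1 * Y + c1 * Z) * (a2 * b3 - b2 * a3)
  - (a2 * X + b2 * Y + c2 * Z) * (a1 * b3 - b1 * a3)
  + (a3 * X + b3 * Y + c3 * Z) * (a1 * b2 - b1 * a2) by rewrite /M; ring.
by split; apply: (mulfI M0); rewrite mulr0 (MX, MY, MZ) e1 e2 e3; ring.
Qed.

(** In the frame [a, b, c] a quadratic form vanishing at these points is a combination of the
    products of two coordinates, which are the coordinates of [quad a b c]. Vanishing at [d, e, f]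
    is then a linear system whose determinant is [con] up to a nonzero factor, by [quad_det0]. *)
Lemma conic_unique a b c d e f (k1 k2 k3 k4 k5 k6 : R) :
  let Q := conic_val k1 k2 k3 k4 k5 k6 in
  [a b c] != 0 -> con a b c d e f != 0 ->
  Q a = 0 -> Q b = 0 -> Q c = 0 -> Q d = 0 -> Q e = 0 -> Q f = 0 ->
  [/\ k1 = 0, k2 = 0, k3 = 0 & [/\ k4 = 0, k5 = 0 & k6 = 0]].
Proof.
move=> Q D0 C0 Qa Qb Qc Qd Qe Qf.
pose B u v := Q (u + v) - Q u - Q v.
have QE (r s t : R) : Q (r *: a + s *: b + t *: c) =
    s * t * B b c + r * t * B a c + r * s * B a b
    + r ^+ 2 * Q a + s ^+ 2 * Q b + t ^+ 2 * Q c.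
  by rewrite /B /Q /conic_val !coordD !coordZ; ring.
have QZ (t : R) x : Q (t *: x) = t ^+ 2 * Q x.
  by rewrite /Q /conic_val !coordZ; ring.
have QQ x : [a b c] ^+ 2 * Q x = [a x c] * [a b x] * B b c
    + [x b c] * [a b x] * B a c + [x b c] * [a x c] * B a b.
  by rewrite -QZ det3_cramer QE Qa Qb Qc !mulr0 !addr0.
have M0 : [(quad a b c d) (quad a b c e) (quad a b c f)] != 0.
  by rewrite quad_det0 mulf_neq0 ?expf_neq0.
rewrite det3_frame mulf_eq0 negb_or D0 andbT in M0.
have [X Y Z] : [/\ B b c = 0, B a c = 0 & B a b = 0].
  by apply: (kernel3 M0); rewrite -QQ (Qd, Qe, Qf) mulr0.
have Q0 x : Q x = 0.
  by apply: (mulfI (expf_neq0 2 D0)); rewrite QQ X Y Z !mulr0 !addr0.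
pose v (r s t : R) : pt R := \row_j [:: r; s; t]`_j.
have vE (r s t : R) : (coord (v r s t) 0 = r) * (coord (v r s t) 1 = s) * (coord (v r s t) 2 = t).
  by rewrite /coord !mxE !inordK.
(* The values at these six vectors determine the six coefficients. *)
have := (Q0 (v 1 0 0), Q0 (v 0 1 0), Q0 (v 0 0 1), Q0 (v 1 1 0), (Q0 (v 1 0 1), Q0 (v 0 1 1))).
rewrite /Q /conic_val !vE => -[[[[e1 e2] e3] e4] [e5 e6]].
by split; [lra.. | split; lra].
Qed.

(** The conic is the member through [e] of the pencil through [a, b, c, d]; [con] is its value at
    [f]. *)
Lemma conic_exists a b c d e f :
  [a b c] != 0 -> [a b d] != 0 -> [a b e] != 0 -> [c d e] != 0 ->
  con a b c d e f = 0 ->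
  exists k1 k2 k3 k4 k5 k6 : R,
    [|| k1 != 0, k2 != 0, k3 != 0, k4 != 0, k5 != 0 | k6 != 0] /\
    (let Q := conic_val k1 k2 k3 k4 k5 k6 in
     [/\ Q a = 0, Q b = 0, Q c = 0 & [/\ Q d = 0, Q e = 0 & Q f = 0]]).
Proof.
move=> abc abd abe cde C0.
pose l u w := (coord u 1 * coord w 2 - coord u 2 * coord w 1,
  coord u 2 * coord w 0 - coord u 0 * coord w 2,
  coord u 0 * coord w 1 - coord u 1 * coord w 0).
have lE u w x : [u w x] =
    (l u w).1.1 * coord x 0 + (l u w).1.2 * coord x 1 + (l u w).2 * coord x 2.
  by rewrite det3E /l /=; ring.
pose m u w u' w' := ((l u w).1.1 * (l u' w').1.1, (l u w).1.2 * (l u' w').1.2,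
  (l u w).2 * (l u' w').2,
  ((l u w).1.1 * (l u' w').1.2 + (l u w).1.2 * (l u' w').1.1,
   (l u w).1.1 * (l u' w').2 + (l u w).2 * (l u' w').1.1,
   (l u w).1.2 * (l u' w').2 + (l u w).2 * (l u' w').1.2)).
pose s := [a b e] * [c d e]; pose t := [a c e] * [b d e].
pose M := m a c b d; pose N := m a b c d.
pose k1 := s * M.1.1.1 - t * N.1.1.1; pose k2 := s * M.1.1.2 - t * N.1.1.2.
pose k3 := s * M.1.2 - t * N.1.2; pose k4 := s * M.2.1.1 - t * N.2.1.1.
pose k5 := s * M.2.1.2 - t * N.2.1.2; pose k6 := s * M.2.2 - t * N.2.2.
exists k1, k2, k3, k4, k5, k6.
have QE x : conic_val k1 k2 k3 k4 k5 k6 x = s * ([a c x] * [b d x]) - t * ([a b x] * [c d x]).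
  by rewrite /conic_val /k1 /k2 /k3 /k4 /k5 /k6 !lE /M /N /m /=; ring.
split; last first.
  rewrite /= !QE !det3aba !det3bb.
  split; [by ring | by ring | by ring | split; [by ring | by rewrite /s /t; ring |]].
  by rewrite -[RHS]C0 /con /s /t; ring.
apply: contraT; rewrite !negb_or !negbK.
move=> /and5P[/eqP e1 /eqP e2 /eqP e3 /eqP e4 /andP[/eqP e5 /eqP e6]].
(* At [a + b], on the line [ab], only the pair [ac|bd] survives, so the form cannot be zero. *)
have := QE (a + b); rewrite /conic_val e1 e2 e3 e4 e5 e6 !mul0r !addr0 !det3D.
rewrite !(det3aba, det3bb) !(add0r, addr0) mul0r mulr0 subr0 => /esym/eqP.
rewrite !mulf_eq0 (negbTE abe) (negbTE cde) /= (det3_swap23 a b c) oppr_eq0 (negbTE abc) /=.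
by rewrite (det3_rot a) (negbTE abd).
Qed.

End Brackets.

(** * Sign vectors of configurations *)

Lemma rels_brackets : all (all (fun t => all (fun l => (srt l).2 \in vars) t.2)) rels.
Proof. by vm_compute. Qed.

Section SignVectors.
Variable R : realType.
Implicit Types (x y z : R) (f g : config R) (s : seq sgn) (l : bracket) (t : term).

Definition sgr x : sgn := if x == 0 then None else Some (x < 0).

Lemma sgrM x y : sgr (x * y) = mulo (sgr x) (sgr y).
Proof.
rewrite /sgr mulf_eq0; have [x0|x0] := eqVneq x 0 => //=.
have [y0|y0] := eqVneq y 0 => //=; congr Some.
have [xp|xn] := ltrP 0 x.
  by rewrite pmulr_rlt0 // (lt_gtF xp).
have {}xn : x < 0 by rewrite lt_neqAle x0.
by rewrite nmulr_rlt0 // xn /= lt_neqAle eq_sym y0 /= leNgt.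
Qed.

Lemma sgr_sign (b : bool) x : sgr ((-1) ^+ b * x) = sgo b (sgr x).
Proof.
case: b; rewrite ?expr0 ?mul1r ?expr1 ?mulN1r /sgr ?oppr_eq0; last by case: eqP.
by case: eqVneq => //= x0; rewrite oppr_lt0 lt_neqAle eq_sym x0 /= leNgt.
Qed.

Lemma sgr_neq0 x : (sgr x != None) = (x != 0).
Proof. by rewrite /sgr; case: (x == 0). Qed.

Lemma sgr_pos x : 0 < x -> sgr x = pos.
Proof. by move=> x0; rewrite /sgr gt_eqF // (lt_gtF x0). Qed.

Lemma sgr_eqP x y : x != 0 -> (sgr x == sgr y) = (0 < x * y).
Proof.
rewrite /sgr => x0; rewrite (negbTE x0); have [->|y0] := eqVneq y 0.
  by rewrite mulr0 ltxx.
rewrite -[_ == _]/((x < 0) == (y < 0)).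
have [xp|xn|/eqP] := ltgtP 0 x; last by rewrite eq_sym (negbTE x0).
  by rewrite pmulr_rgt0 //; case: ltgtP y0 => // ->; rewrite eqxx.
by rewrite nmulr_rgt0 //; case: (y < 0).
Qed.

Definition bval f l : R :=
  let p i := f (inord i) in
  match l with
  | [:: a; b; c] => det3 (p a) (p b) (p c)
  | [:: a; b; c; d; e; g] => con (p a) (p b) (p c) (p d) (p e) (p g)
  | _ => 0
  end.

Definition sv f : seq sgn := [seq sgr (bval f l) | l <- vars].

Lemma bval_swap f l1 i j l2 : bval f (l1 ++ i :: j :: l2) = - bval f (l1 ++ j :: i :: l2).
Proof.
case: l1 => [|a1 [|a2 [|a3 [|a4 [|a5 l1]]]]] /=;
  case: l2 => [|b1 [|b2 [|b3 [|b4 [|b5 l2]]]]] //=; rewrite ?oppr0 //.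
- by rewrite det3_swap12.
- by rewrite con_swap12.
- by rewrite det3_swap23.
- by rewrite con_swap23.
- by rewrite con_swap34.
- by rewrite con_swap45.
- by rewrite con_swap56.
all: by case: l1 => [|? [|? ?]] /=; rewrite oppr0.
Qed.

Lemma bval_ins f l1 i l : bval f (l1 ++ i :: l) = (-1) ^+ (ins i l).1 * bval f (l1 ++ (ins i l).2).
Proof.
elim: l l1 => [|j l IHl] l1 /=; first by rewrite mul1r.
case: ifP => _ /=; first by rewrite mul1r.
have := IHl (rcons l1 j); case: (ins i l) => b m /=; rewrite !cat_rcons => E.
by rewrite bval_swap E signrN mulNr.
Qed.

Lemma bval_srt f l : bval f l = (-1) ^+ (srt l).1 * bval f (srt l).2.
Proof.
rewrite -[l in LHS]cat0s -[(srt l).2]cat0s.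
elim: l [::] => [|i l IHl] l1 /=; first by rewrite mul1r.
rewrite -cat_rcons IHl cat_rcons; case: (srt l) => b m /=.
by rewrite bval_ins; case: (ins i m) => c k /=; rewrite mulrA signr_addb.
Qed.

Lemma lk_sv f l : (srt l).2 \in vars -> lk (sv f) l = sgr (bval f l).
Proof.
rewrite /lk bval_srt; case: (srt l) => b m /= m_v; rewrite sgr_sign; congr sgo.
by rewrite /sv (nth_map [::]) ?index_mem ?nth_index.
Qed.

(** A prefix never yields a wrong sign, only [None]; this makes computations with partial sign
    vectors sound. *)
Lemma lk_take_Some f m l b : lk (take m (sv f)) l = Some b -> sgr (bval f l) = Some b.
Proof.
rewrite /lk bval_srt; case: (srt l) => c k /=; rewrite sgr_sign.
have [k_m|m_k] := ltnP (index k vars) (size (take m (sv f))); last first.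
  by rewrite nth_default.
have k_m' : (index k vars < m)%N.
  by move: k_m; rewrite size_take_min leq_min => /andP[].
rewrite nth_take //; have [k_v|k_v] := boolP (k \in vars).
  by rewrite /sv (nth_map [::]) ?index_mem ?nth_index.
by rewrite nth_default // size_map leqNgt index_mem.
Qed.

Definition tval f t : R := (-1) ^+ t.1 * \prod_(l <- t.2) bval f l.

Lemma tsgn_sv f t : all (fun l => (srt l).2 \in vars) t.2 -> tsgn (sv f) t = sgr (tval f t).
Proof.
case: t => b ls /= H; rewrite /tsgn /tval sgr_sign /=; congr sgo.
elim: ls H => [|l ls IHl] /=; first by rewrite big_nil /sgr oner_eq0 ltr10.
by move=> /andP[l_v /IHl ->]; rewrite lk_sv // big_cons sgrM.
Qed.

Lemma ctsgn_sv f t : all (fun l => (srt l).2 \in vars) t.2 ->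
  ctsgn (sv f) (compile t) = sgr (tval f t).
Proof.
case: t => b ls /= H; rewrite /ctsgn /tval /compile /=.
elim: ls H => [|l ls IHl] /=.
  by rewrite big_nil sgr_sign /sgr oner_eq0 ltr10.
move=> /andP[l_v /IHl]; rewrite big_cons bval_srt.
case: (srt l) l_v => c m /= l_v; case: (foldr _ _ ls) => b' is_ /= E.
rewrite (_ : _ * _ = (-1) ^+ c * (bval f m * ((-1) ^+ b * \prod_(j <- ls) bval f j))); last by ring.
rewrite sgr_sign sgrM -E /sv (nth_map [::]) ?index_mem // nth_index //.
by case: (sgr (bval f m)) => //= u; case: (foldr _ _ is_) => //= v; rewrite -addbA (addbCA u).
Qed.

Lemma zero_sum3 x y z : x + y + z = 0 -> zero_sum [:: sgr x; sgr y; sgr z].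
Proof.
move=> E; rewrite /zero_sum /sgr.
case: (ltgtP x 0); case: (ltgtP y 0); case: (ltgtP z 0) => // z0 y0 x0; exfalso; lra.
Qed.

Lemma rel_sv f r : r \in rels -> zero_sum [seq tsgn (sv f) t | t <- r].
Proof.
have tval3 t1 t2 t3 : tval f t1 + tval f t2 + tval f t3 = 0 ->
    [:: t1; t2; t3] \in rels -> zero_sum [seq tsgn (sv f) t | t <- [:: t1; t2; t3]].
  move=> E r_rels; have /and4P[ok1 ok2 ok3 _] := allP rels_brackets _ r_rels.
  have -> : [seq tsgn (sv f) t | t <- [:: t1; t2; t3]] =
    [:: tsgn (sv f) t1; tsgn (sv f) t2; tsgn (sv f) t3] by [].
  by rewrite (tsgn_sv f ok1) (tsgn_sv f ok2) (tsgn_sv f ok3); exact: zero_sum3.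
move=> r_rels; have := r_rels; rewrite {1}/rels mem_cat => /orP[|]; last rewrite mem_cat => /orP[].
- move=> /allpairsPdep[x [c [_ _ re]]]; rewrite re in r_rels *; apply: tval3 r_rels.
  rewrite /tval !big_cons !big_nil !mulr1 !mul1r expr1 mulN1r; exact: plucker.
- move=> /flattenP[rs /mapP[i _ ->] /allpairsPdep[e [q [_ _ re]]]].
  rewrite re in r_rels *; apply: tval3 r_rels.
  by rewrite /tval !big_cons !big_nil !mulr1 !mul1r expr1 /= /con; ring.
- move=> /allpairsPdep[efg [q [_ _ re]]]; rewrite re in r_rels *; apply: tval3 r_rels.
  by rewrite /tval !big_cons !big_nil !mulr1 !mul1r !mulrA; exact: con_pencil.
Qed.

Lemma crel_sv f r : r \in crels -> zero_sum [seq ctsgn (sv f) u | u <- r].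
Proof.
move=> /mapP[r' r'_rels ->]; rewrite -map_comp.
have /eq_in_map -> : {in r', ctsgn (sv f) \o compile =1 tsgn (sv f)}.
  move=> t t_r'; have t_ok := allP (allP rels_brackets _ r'_rels) _ t_r'.
  exact: etrans (ctsgn_sv f t_ok) (esym (tsgn_sv f t_ok)).
exact: rel_sv.
Qed.

Lemma leq_last_var (r : seq cterm) (t : cterm) : t \in r -> (foldr maxn 0 t.2 <= last_var r)%N.
Proof.
have acc m (k : seq nat) : foldr maxn m k = maxn m (foldr maxn 0%N k).
  by elim: k => [|i k /= ->]; rewrite ?maxn0 // maxnCA.
rewrite /last_var; elim: r => //= u r IHr; rewrite inE [X in (_ <= X)%N]acc leq_max.
by move=> /predU1P[->|/IHr ->]; rewrite ?leqnn ?orbT.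
Qed.

(** Soundness of the search: a true sign vector passes all tests, hence is never pruned. *)
Lemma extend_sv f cs n L : (n + size cs <= size vars)%N ->
  (forall i, (i < size cs)%N -> nth None (sv f) (n + i) \in nth [::] cs i) ->
  take n (sv f) \in L -> take (n + size cs) (sv f) \in extend cs n L.
Proof.
elim: cs n L => [|c cs IHcs] n L /=; first by rewrite addn0.
rewrite addnS -addSn => size_n cs_ok sv_L.
apply: (IHcs n.+1 _ size_n); first by move=> i i_cs; rewrite addSnnS; exact: (cs_ok i.+1).
have n_lt : (n < size (sv f))%N.
  by rewrite size_map; apply: leq_trans size_n; rewrite ltnS leq_addr.
rewrite mem_filter (take_nth None n_lt); apply/andP; split; last first.
  apply/allpairsP; exists (take n (sv f), nth None (sv f) n); split=> //=.
  by have := cs_ok 0%N isT; rewrite addn0.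
rewrite -(take_nth None n_lt); apply/allP => r; rewrite mem_filter => /andP[/eqP rn r_crels].
(* A relation whose last bracket is at position [n] reads only the first [n.+1] signs. *)
suff /eq_in_map -> : {in r, ctsgn (take n.+1 (sv f)) =1 ctsgn (sv f)} by exact: crel_sv.
move=> t t_r; rewrite /ctsgn; congr sgo.
have := leq_last_var t_r; rewrite rn; elim: t.2 => [//|i k IHk].
rewrite geq_max => /andP[i_n /IHk E]; rewrite [LHS]/= [RHS]/= E.
by rewrite nth_take.
Qed.

End SignVectors.

(** * Relabelling, rescaling and equality of configurations *)

Lemma vars_lt7 : all (all (gtn 7)) vars.
Proof. by vm_compute. Qed.

Section Equivalence.
Variable R : realType.
Implicit Types (f g h : config R) (k : 'I_7 -> R) (p : seq nat).

(** With the default [i] the points beyond the end of [p] stay fixed, so a permutation of the first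
    [n] labels acts on the whole configuration. *)
Definition relab p f : config R := fun i => f (inord (nth (i : nat) p i)).
Definition scale k f : config R := fun i => k i *: f i.

Lemma bval_relab p f l : all (gtn 7) l -> bval (relab p f) l = bval f [seq nth i p i | i <- l].
Proof.
have E i : gtn 7 i -> relab p f (inord i) = f (inord (nth i p i)).
  by move=> /= i7; rewrite /relab inordK.
case: l => [|a [|b [|c [|d [|e [|g [|? ?]]]]]]] //=.
- by case/and4P => *; rewrite !E.
- by move=> /andP[? /andP[? /andP[? /and4P[]]]] *; rewrite !E.
Qed.

Lemma act_sv p f m : None \notin act p (take m (sv f)) ->
  act p (take m (sv f)) = take m (sv (relab p f)).
Proof.
have -> : act p (take m (sv f)) =
    [seq lk (take m (sv f)) [seq nth i p i | i <- l] | l <- take m vars].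
  by rewrite /act size_take_min size_map take_min take_size.
move=> noN; rewrite [in RHS]/sv -[RHS]map_take; apply/eq_in_map => l l_vars.
rewrite bval_relab; last by apply: (allP vars_lt7); exact: mem_take l_vars.
case E: (lk _ _) => [b|]; first by rewrite (lk_take_Some E).
by case/negP: noN; rewrite -E; apply: map_f l_vars.
Qed.

Lemma bval_scale k f l : (forall i, k i != 0) -> sgr (bval (scale k f) l) =
  sgo ((size l == 3%N) && foldr (fun i b => (k (inord i) < 0) (+) b) false l) (sgr (bval f l)).
Proof.
move=> k0.
have sgk i : sgr (k i) = Some (k i < 0) by rewrite /sgr (negbTE (k0 i)).
case: l => [|a [|b [|c [|d [|e [|g [|? ?]]]]]]]; rewrite [size _ == _]/= /= /scale.
1-3,5,6,8: by rewrite /sgr eqxx.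
- rewrite det3Z !sgrM !sgk; case: (sgr _) => //= u; congr Some.
  by rewrite addbF !addbA.
- rewrite conZ expr2 -mulrA !sgrM !sgk; case: (sgr _) => //= u; congr Some.
  by rewrite addKb.
Qed.

Lemma reor_sv k f : (forall i, k i != 0) ->
  sv (scale k f) = reor (fun i => k (inord i) < 0) (sv f).
Proof.
move=> k0; rewrite /reor /sv -{2}[vars]map_id zip_map -map_comp.
by apply/eq_map => l; rewrite bval_scale.
Qed.

Lemma take_reor e m (s : seq sgn) : take m (reor e s) = reor e (take m s).
Proof.
rewrite /reor -map_take; congr map.
elim: m s vars => [|m IHm] [|x s] [|l v] //=.
by rewrite IHm.
Qed.

(** Whatever signs [eps] selects, [norm] is a reorientation and is realized by scaling each point by
    a sign. *)
Lemma norm_sv f m : exists2 k, (forall i, k i != 0) &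
  take m (sv (scale k f)) = norm (take m (sv f)).
Proof.
pose e := [seq eps (take m (sv f)) i | i <- pts].
exists (fun i => (-1) ^+ nth false e i); first by move=> i; rewrite signr_eq0.
rewrite reor_sv ?take_reor; last by move=> i; rewrite signr_eq0.
rewrite /norm -/e /reor; apply/eq_in_map => -[l x] lx.
have l7 : all (gtn 7) l.
  apply: (allP vars_lt7); move: lx; elim: vars (take m (sv f)) => [|l' v IHv] [|x' s] //=.
  by rewrite !inE => /predU1P[[-> _]|/IHv ->]; rewrite ?eqxx ?orbT.
congr (sgo (_ && _) _); rewrite /=; elim: l l7 {lx} => //= i l IHl /andP[i7 /IHl ->].
congr addb; rewrite inordK //; case: (nth _ _ _); rewrite ?expr0 ?expr1 ?ltr10 //.
by rewrite ltrN10.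
Qed.

Lemma same_configP f g : same_config f g <->
  exists s : 'S_7, exists2 k, (forall i, k i != 0) & f = scale k (fun i => g (s i)).
Proof.
split=> [[s fg]|[s [k k0 ->]]]; exists s; last by move=> i; exists (k i).
have /choice[k kP] : forall i, exists r, r != 0 /\ f i = r *: g (s i) by exact: fg.
by exists k => [i|]; [have [] := kP i | apply/funext => i; have [] := kP i].
Qed.

Lemma same_refl f : same_config f f.
Proof. by exists 1%g => i; exists 1; rewrite perm1 scale1r oner_neq0. Qed.

Lemma same_sym f g : same_config f g -> same_config g f.
Proof.
move=> [s fg]; exists s^-1%g => i; have [r [r0 E]] := fg (s^-1 i)%g.
exists r^-1; rewrite invr_eq0 r0 E permKV scalerA mulVf // scale1r.
by split.
Qed.

Lemma same_trans f g h : same_config f g -> same_config g h -> same_config f h.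
Proof.
move=> [s fg] [s' gh]; exists (s * s')%g => i.
have [r [r0 ->]] := fg i; have [r' [r0' ->]] := gh (s i).
by exists (r * r'); rewrite mulf_neq0 // scalerA permM.
Qed.

Lemma same_scale k f : (forall i, k i != 0) -> same_config (scale k f) f.
Proof. by move=> k0; exists 1%g => i; exists (k i); rewrite perm1. Qed.

Lemma same_relab n p f : (n <= 7)%N -> perm_eq p (iota 0 n) -> same_config (relab p f) f.
Proof.
move=> n7 pn; have sz : size p = n by rewrite (perm_size pn) size_iota.
have inj : injective (fun i : 'I_7 => inord (nth (i : nat) p i) : 'I_7).
  have lt7 (i : nat) : (i < 7)%N -> (nth i p i < 7)%N.
    move=> i7; have [ip|pi] := ltnP i (size p); last by rewrite nth_default.
    have := mem_nth i ip; rewrite (perm_mem pn) mem_iota => /leq_trans; apply.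
    by rewrite add0n.
  move=> i j /(congr1 val); rewrite /= !inordK ?lt7 // => E; apply/val_inj => /=.
  have up : uniq p by rewrite (perm_uniq pn) iota_uniq.
  move: E; have [ip|pi] := ltnP i (size p); have [jp|pj] := ltnP j (size p).
  - by rewrite (set_nth_default (val i) (val j) jp) => /eqP; rewrite nth_uniq // => /eqP.
  - rewrite (nth_default _ pj) => E; have := mem_nth (val i) ip.
    by rewrite E (perm_mem pn) mem_iota add0n ltnNge -sz pj andbF.
  - rewrite (nth_default _ pi) => E; have := mem_nth (val j) jp.
    by rewrite -E (perm_mem pn) mem_iota add0n ltnNge -sz pi andbF.
  - by rewrite !nth_default.
by exists (perm inj) => i; exists 1; rewrite oner_neq0 scale1r permE.
Qed.

Lemma conic_valZ (k1 k2 k3 k4 k5 k6 r : R) (x : pt R) :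
  conic_val k1 k2 k3 k4 k5 k6 (r *: x) = r ^+ 2 * conic_val k1 k2 k3 k4 k5 k6 x.
Proof. by rewrite /conic_val !coordZ; ring. Qed.

Lemma typical_same f g : same_config g f -> typical f -> typical g.
Proof.
move=> /same_configP[s [k k0 ->]] [[f0 fp fd] fc]; have inj := @perm_inj _ s.
split; first split.
- by move=> i; rewrite scaler_eq0 negb_or k0 f0.
- move=> i j ij [r [r0]]; rewrite /scale => E.
  apply: (fp (s i) (s j)); first by rewrite (inj_eq inj).
  exists ((k i)^-1 * (r * k j)); split; first by rewrite !mulf_neq0 ?invr_eq0.
  by rewrite -!scalerA -E scalerA mulVf ?scale1r.
- move=> i j l ij jl il; rewrite /scale det3Z !mulf_neq0 ?fd ?(inj_eq inj) //.
move=> S S6 [k1 [k2 [k3 [k4 [k5 [k6 [k_neq0 Q0]]]]]]].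
apply: (fc (s @: S)); first by rewrite card_imset.
exists k1, k2, k3, k4, k5, k6; split=> // _ /imsetP[i iS ->].
have /eqP := Q0 _ iS; rewrite conic_valZ mulf_eq0 expf_eq0 (negbTE (k0 _)) andbF /=.
by move=> /eqP.
Qed.

End Equivalence.

(** * Typical configurations as those without vanishing bracket *)

Lemma vars_shape : all (fun l => match l with
  | [:: i; j; k] => [&& i < j, j < k & k < 7]%N
  | [:: _; _; _; _; _; _] => has (fun i => six i == l) pts
  | _ => false end) vars.
Proof. by vm_compute. Qed.

Lemma triples_vars : all (fun i => all (fun j => all (fun k =>
  [|| i == j, j == k, i == k | (srt [:: i; j; k]).2 \in vars]) pts) pts) pts.
Proof. by vm_compute. Qed.

Lemma six_vars : all (fun i => six i \in vars) pts.
Proof. by vm_compute. Qed.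

Section Typical.
Variable R : realType.
Implicit Types (f g h : config R) (p : seq nat).

Lemma mem_pts i : (i \in pts) = (i < 7)%N.
Proof. by rewrite mem_iota. Qed.

Lemma exists_third (i j : 'I_7) : exists k, (k != i) && (k != j).
Proof.
have /card_gt0P[k] : (0 < #|[set~ i] :\ j|)%N.
  have := cardsD1 j [set~ i]; rewrite cardsC1 card_ord.
  by case: (j \in _); case: #|_|.
by rewrite !inE => /andP[kj ki]; exists k; rewrite ki.
Qed.

Lemma sv_noneP f : reflect (forall l, l \in vars -> bval f l != 0) (None \notin sv f).
Proof.
apply: (iffP negP) => [H l l_v|H /mapP[l l_v /esym/eqP]]; last first.
  by apply/negP; rewrite sgr_neq0 H.
by apply/eqP => E; apply: H; apply/mapP; exists l => //; rewrite /sgr E eqxx.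
Qed.

Lemma bval_triple_neq0 f (i j k : 'I_7) : None \notin sv f ->
  i != j -> j != k -> i != k -> det3 (f i) (f j) (f k) != 0.
Proof.
move=> /sv_noneP fN ij jk ik.
have := allP (allP (allP triples_vars i _) j _) k _; rewrite !mem_pts.
move=> /(_ (ltn_ord i) (ltn_ord j) (ltn_ord k)).
have -> : (i == j :> nat) = false by apply/negbTE.
have -> : (j == k :> nat) = false by apply/negbTE.
have -> : (i == k :> nat) = false by apply/negbTE.
move=> /fN; have := bval_srt f [:: (i : nat); (j : nat); (k : nat)]; rewrite [LHS]/= !inord_val => ->.
by move=> ?; rewrite mulf_neq0 ?signr_eq0.
Qed.

(** Six points are the complement of one, and [con] detects their conic by [conic_unique] and
    [conic_exists], whose conditions on triples hold for simple configurations. *)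
Lemma typicalP f : typical f <-> None \notin sv f.
Proof.
split=> [[[f0 fp fd] fc]|fN]; last split; first last.
- move=> S S6 [k1 [k2 [k3 [k4 [k5 [k6 [k_neq0 Q0]]]]]]].
  have /cards1P[m Sm] : #|~: S| == 1%N by rewrite cardsCs finset.setCK card_ord S6.
  have : six m \in vars by apply: (allP six_vars); rewrite mem_pts.
  have sz6 : size (six m) = 6%N by case: m {Sm} => -[|[|[|[|[|[|[|]]]]]]].
  have Q i : i \in six m -> conic_val k1 k2 k3 k4 k5 k6 (f (inord i)) = 0.
    rewrite mem_filter mem_pts => /andP[im i7]; apply: Q0.
    rewrite -[S]finset.setCK Sm !inE; apply: contraNneq im => <-; by rewrite inordK.
  have u6 : uniq (six m) by rewrite filter_uniq ?iota_uniq.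
  have lt6 i : i \in six m -> (i < 7)%N by rewrite mem_filter mem_pts => /andP[].
  move: (six m) sz6 Q u6 lt6 => [|a [|b [|c [|d [|e [|g [|? ?]]]]]]] // _ Q u6 lt6 l_v.
  have /sv_noneP/(_ _ l_v) C0 := fN.
  have abc : det3 (f (inord a)) (f (inord b)) (f (inord c)) != 0.
    move: u6; rewrite /= !inE !negb_or => /and3P[/and5P[ab ac _ _ _] /andP[bc _] _].
    apply: bval_triple_neq0 => //; rewrite -val_eqE /= !inordK ?lt6 // ?inE ?eqxx ?orbT //.
  have [] := @conic_unique R _ _ _ _ _ _ k1 k2 k3 k4 k5 k6 abc C0;
    do ?by apply: Q; rewrite !inE eqxx ?orbT.
  by move=> E1 E2 E3 [E4 E5 E6]; move: k_neq0; rewrite E1 E2 E3 E4 E5 E6 eqxx.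
- split=> [i|i j ij [r [r0 E]]|i j k ij jk ik]; last exact: bval_triple_neq0.
    have [j /andP[ji _]] := exists_third i i; have [k /andP[ki kj]] := exists_third i j.
    have := bval_triple_neq0 fN ji (_ : i != k) (_ : j != k).
    rewrite eq_sym ki eq_sym kj => /(_ isT isT); apply: contraNneq => ->.
    by rewrite -(scale0r (f i)) det3_swap23 det3Zr mul0r oppr0.
  have [k /andP[ki kj]] := exists_third i j.
  have := bval_triple_neq0 fN ij (_ : j != k) (_ : i != k).
  rewrite eq_sym kj eq_sym ki => /(_ isT isT); rewrite E -[f j in X in det3 _ X]scale1r -[f k]scale1r det3Z.
  by rewrite det3aa mulr0 eqxx.
- apply/sv_noneP => l l_v; have := allP vars_shape _ l_v.
  case: l l_v => [|a [|b [|c [|d [|e [|g [|? ?]]]]]]] // l_v.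
    move=> /and3P[ab bc c7]; have b7 := ltn_trans bc c7; have a7 := ltn_trans ab b7.
    have ac := ltn_trans ab bc.
    by rewrite /=; apply: fd; rewrite -val_eqE /= !inordK ?ltn_eqF.
  move=> /hasP[m m7 /eqP E]; apply/eqP => C0.
  have u6 : uniq [:: a; b; c; d; e; g] by rewrite -E filter_uniq ?iota_uniq.
  have lt6 i : i \in [:: a; b; c; d; e; g] -> (i < 7)%N by rewrite -E mem_filter mem_pts => /andP[].
  apply: (fc [set~ inord m]); first by rewrite cardsC1 card_ord.
  have Dt i j k : i \in [:: a; b; c; d; e; g] -> j \in [:: a; b; c; d; e; g] ->
      k \in [:: a; b; c; d; e; g] -> i != j -> j != k -> i != k ->
      det3 (f (inord i)) (f (inord j)) (f (inord k)) != 0.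
    by move=> /lt6 i7 /lt6 j7 /lt6 k7 ij jk ik; apply: fd; rewrite -val_eqE /= !inordK.
  have [] := @conic_exists R (f (inord a)) (f (inord b)) (f (inord c)) (f (inord d))
    (f (inord e)) (f (inord g)) _ _ _ _ C0.
  all: move: (u6); rewrite /= !inE !negb_or => /and5P[/and5P[ab ac ad ae ag] /and4P[bc bd be bg]
     /and3P[cd ce cg] /andP[de dg] _].
  1-4: by apply: Dt; rewrite ?inE ?eqxx ?orbT.
  move=> k1 [k2 [k3 [k4 [k5 [k6 [k_neq0 [Qa Qb Qc [Qd Qe Qg]]]]]]]].
  exists k1, k2, k3, k4, k5, k6; split=> // i; rewrite in_setC1 => im.
  have : (i : nat) \in six m.
    by rewrite mem_filter mem_pts ltn_ord andbT; apply: contraNneq im => <-; rewrite inord_val.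
  by rewrite E !inE => /or4P[|||/or3P[]] /eqP Ei; rewrite -[i]inord_val Ei.
Qed.

End Typical.

(** * Reduction to fourteen sign vectors *)

Lemma reduces2 : reduces 2 [:: [::]] wit3 [:: take 1 s0].
Proof. by vm_compute. Qed.

Lemma reduces3 : reduces 3 [:: take 1 s0] wit4 [:: take 4 s0].
Proof. by vm_compute. Qed.

Lemma reduces4 : reduces 4 [:: take 4 s0] wit5 classes5.
Proof. by vm_compute. Qed.

Lemma reduces5 : reduces 5 classes5 wit6 classes6.
Proof. by vm_compute. Qed.

(** The classes come out of [tree] in arbitrary orientations, hence [norm] on the right. *)
Lemma reduces6 : reduces 6 classes6 wit7 (map norm classes).
Proof. by vm_compute. Qed.

Section Reduction.
Variable R : realType.
Implicit Types (f g h : config R).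

Lemma reduces_sv n L wit L' f : (2 <= n <= 6)%N -> reduces n L wit L' -> typical f ->
  take (nvars n) (sv f) \in L ->
  exists g, [/\ same_config g f, typical g & take (nvars n.+1) (sv g) \in L'].
Proof.
move=> n26 red ft fL.
have [lt7 [nv1 [nv2 nthv]]] : all (all (gtn n)) (take (nvars n) vars) /\
    (nvars n + (nvars n.+1 - nvars n) = nvars n.+1)%N /\
    (nvars n < nvars n.+1 <= size vars)%N /\ nth [::] vars (nvars n) = [:: 0; 1; n]%N.
  by case: n n26 {red fL} => [|[|[|[|[|[|[|n]]]]]]] // _; do !split; vm_compute.
have n7 : (n < 7)%N by case/andP: n26.
have n2 : (1 < n)%N by case/andP: n26.
have nv3 : (nvars n < size vars)%N by case/andP: nv2 => /leq_trans; apply.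
pose x := bval f [:: 0; 1; n]%N.
have x0 : x != 0.
  by have /typicalP/sv_noneP := ft; apply; rewrite -nthv mem_nth.
(* Scaling the new point by the value of its bracket with 0 and 1 turns that value into a square and
   leaves the brackets of the earlier points alone. *)
pose k (i : 'I_7) := if i == n :> nat then x else 1.
have k0 i : k i != 0 by rewrite /k; case: ifP => //; rewrite oner_neq0.
pose f1 := scale k f.
have f1f : same_config f1 f by exact: same_scale.
have f1t : typical f1 by exact: typical_same f1f ft.
have f1L : take (nvars n) (sv f1) \in L.
  rewrite (_ : take _ _ = take (nvars n) (sv f)) //.
  rewrite -!map_take; apply/eq_in_map => l l_v.
  rewrite bval_scale //; have ln := allP lt7 _ l_v.
  suff -> : foldr (fun i b => (k (inord i) < 0) (+) b) false l = false.
    by rewrite andbF; case: (sgr _) => // b.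
  elim: l ln {l_v} => //= i l IHl /andP[i_n /IHl ->].
  by rewrite /k inordK ?(ltn_trans i_n) // (ltn_eqF i_n) ltr10.
have x_pos : nth None (sv f1) (nvars n) = pos.
  rewrite (nth_map [::]) // nthv; apply: sgr_pos.
  rewrite /= /f1 /scale det3Z /k !inordK // eqxx.
  rewrite [0%N == n]ltn_eqF ?(ltn_trans _ n2) // [1%N == n]ltn_eqF // !mul1r.
  by rewrite -expr2 exprn_even_gt0.
have f1l : take (nvars n.+1) (sv f1) \in leaves n L.
  rewrite -nv1 (_ : (_ - _)%N = size (([:: pos] :: nseq (nvars n.+1 - nvars n).-1 nonzero))).
    apply: extend_sv => // [|i].
      by rewrite /= size_nseq prednK ?subn_gt0 ?nv1; case/andP: nv2.
    rewrite /= size_nseq prednK ?subn_gt0; last by case/andP: nv2.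
    case: i => [|i] i_lt; first by rewrite addn0 x_pos mem_head.
    rewrite /= nth_nseq -(ltn_add2r 1) !addn1 prednK ?subn_gt0 ?i_lt; last by case/andP: nv2.
    have i_v : (nvars n + i.+1 < size vars)%N.
      by case/andP: nv2 => _; apply: leq_trans; rewrite -ltn_subRL.
    have /typicalP/sv_noneP/(_ _ (mem_nth [::] i_v)) := f1t.
    rewrite (nth_map [::]) // /sgr => /negbTE ->.
    by case: (_ < 0).
  by rewrite /= size_nseq prednK // subn_gt0; case/andP: nv2.
move: red; rewrite /reduces; set M := leaves n L => /andP[/eqP szM /allP chk].
pose i := index (take (nvars n.+1) (sv f1)) M.
have iM : (i < size M)%N by rewrite index_mem.
have /chk : nth (take (nvars n.+1) (sv f1), BinNums.N0) (zip M wit) i \in zip M wit.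
  by apply: mem_nth; rewrite size_zip -szM minnn.
rewrite nth_zip //= nth_index //; set p := digits _ _ => /and3P[pp noN actL].
have f2f : same_config (relab p f1) f1 by exact: (same_relab (n := n.+1)).
rewrite act_sv // in actL.
have [k' k'0 E] := norm_sv (relab p f1) (nvars n.+1).
have f3f : same_config (scale k' (relab p f1)) f by
  apply: same_trans f1f; apply: same_trans f2f; exact: same_scale.
exists (scale k' (relab p f1)); split=> //; first exact: typical_same f3f ft.
by rewrite E.
Qed.

Lemma take_nvars7 f : take (nvars 7) (sv f) = sv f.
Proof. by apply: take_oversize; rewrite size_map; vm_compute. Qed.

Lemma classification f : typical f -> exists2 g, same_config g f &
  exists2 i, (i < size classes)%N & sv g = norm (nth [::] classes i).
Proof.
move=> ft; have l2 : take (nvars 2) (sv f) \in [:: [::]] by rewrite take0.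
have [g3 [s3 t3 l3]] := @reduces_sv 2 _ _ _ _ isT reduces2 ft l2.
have [g4 [s4 t4 l4]] := @reduces_sv 3 _ _ _ _ isT reduces3 t3 l3.
have [g5 [s5 t5 l5]] := @reduces_sv 4 _ _ _ _ isT reduces4 t4 l4.
have [g6 [s6 t6 l6]] := @reduces_sv 5 _ _ _ _ isT reduces5 t5 l5.
have [g7 [s7 t7 l7]] := @reduces_sv 6 _ _ _ _ isT reduces6 t6 l6.
exists g7.
  exact: same_trans s7 (same_trans s6 (same_trans s5 (same_trans s4 s3))).
move: l7; rewrite take_nvars7 => /mapP[s /(nthP [::])[i i_lt <-] E].
by exists i; [exact: i_lt | exact: E].
Qed.

End Reduction.

(** * The quadratic transformation on sign vectors *)

Lemma crt_brackets : all (fun l => all (fun l' => (srt l').2 \in vars) (crt l).2) vars.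
Proof. by vm_compute. Qed.

Section CremonaSigns.
Variable R : realType.
Implicit Types (f g h : config R) (x y z w : nat).

Definition Cr f : config R := fun i =>
  if (i < 3)%N then f i else quad (f (inord 0)) (f (inord 1)) (f (inord 2)) (f i).

Lemma sgr_sqr (r s : R) : r != 0 -> sgr (r ^+ 2 * s) = sgr s.
Proof.
move=> r0; rewrite expr2 !sgrM /sgr (negbTE r0) /= addbb.
by case: (s == 0).
Qed.

Section Families.
Variable f : config R.
Hypothesis D0 : bval f [:: 0; 1; 2]%N != 0.
Let D := det3 (f (inord 0)) (f (inord 1)) (f (inord 2)).

Definition same_sign l := sgr (bval (Cr f) l) = sgr (tval f (crt l)).

Lemma Cr_lo : (Cr f (inord 0) = f (inord 0)) * (Cr f (inord 1) = f (inord 1)) *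
  (Cr f (inord 2) = f (inord 2)).
Proof. by rewrite /Cr !inordK. Qed.

Lemma Cr_hi i : (2 < i < 7)%N ->
  Cr f (inord i) = quad (f (inord 0)) (f (inord 1)) (f (inord 2)) (f (inord i)).
Proof. by move=> /andP[i3 i7]; rewrite /Cr inordK // ltnNge i3. Qed.

Definition hi := [:: 3; 4; 5; 6]%N.

(** Disposes of the even powers of the base determinant that [crt] omits. *)
Lemma same_sign_sqr (k : nat) (v t : R) : v = D ^+ (2 * k) * t -> sgr v = sgr t.
Proof. by move=> ->; rewrite exprM exprAC sgr_sqr // expf_neq0. Qed.

Lemma sign_triple2 x : x \in hi ->
  [/\ same_sign [:: 0; 1; x]%N, same_sign [:: 0; 2; x]%N & same_sign [:: 1; 2; x]%N].
Proof.
move=> xh; have x7 : (2 < x < 7)%N by move: xh; rewrite !inE => /or4P[] /eqP ->.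
(* [crt] computes only on actual labels, hence the case analysis on [x]; the algebra that follows is
   uniform in [x]. *)
have -> : same_sign [:: 0; 1; x]%N = (sgr (bval (Cr f) [:: 0; 1; x]%N) = sgr (tval f
   (false, [:: [:: 0; 1; 2]; [:: x; 1; 2]; [:: 0; x; 2]]%N))).
  by move: xh; rewrite !inE => /or4P[] /eqP ->.
have -> : same_sign [:: 0; 2; x]%N = (sgr (bval (Cr f) [:: 0; 2; x]%N) = sgr (tval f
   (true, [:: [:: 0; 1; 2]; [:: x; 1; 2]; [:: 0; 1; x]]%N))).
  by move: xh; rewrite !inE => /or4P[] /eqP ->.
have -> : same_sign [:: 1; 2; x]%N = (sgr (bval (Cr f) [:: 1; 2; x]%N) = sgr (tval f
   (false, [:: [:: 0; 1; 2]; [:: 0; x; 2]; [:: 0; 1; x]]%N))).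
  by move: xh; rewrite !inE => /or4P[] /eqP ->.
rewrite /tval !big_cons !big_nil /bval !Cr_lo !(Cr_hi x7).
split; congr sgr.
- by rewrite quad_det12; ring.
- by rewrite quad_det13; ring.
- by rewrite quad_det23; ring.
Qed.

Lemma sign_triple1 x y : x \in hi -> y \in hi ->
  [/\ same_sign [:: 0; x; y]%N, same_sign [:: 1; x; y]%N & same_sign [:: 2; x; y]%N].
Proof.
move=> xh yh.
have x7 : (2 < x < 7)%N by move: xh; rewrite !inE => /or4P[] /eqP ->.
have y7 : (2 < y < 7)%N by move: yh; rewrite !inE => /or4P[] /eqP ->.
have -> : same_sign [:: 0; x; y]%N = (sgr (bval (Cr f) [:: 0; x; y]%N) = sgr (tval f
   (true, [:: [:: 0; x; y]; [:: x; 1; 2]; [:: y; 1; 2]]%N))).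
  by move: xh yh; rewrite !inE => /or4P[] /eqP -> /or4P[] /eqP ->.
have -> : same_sign [:: 1; x; y]%N = (sgr (bval (Cr f) [:: 1; x; y]%N) = sgr (tval f
   (true, [:: [:: 1; x; y]; [:: 0; x; 2]; [:: 0; y; 2]]%N))).
  by move: xh yh; rewrite !inE => /or4P[] /eqP -> /or4P[] /eqP ->.
have -> : same_sign [:: 2; x; y]%N = (sgr (bval (Cr f) [:: 2; x; y]%N) = sgr (tval f
   (true, [:: [:: 2; x; y]; [:: 0; 1; x]; [:: 0; 1; y]]%N))).
  by move: xh yh; rewrite !inE => /or4P[] /eqP -> /or4P[] /eqP ->.
rewrite /tval !big_cons !big_nil /bval !Cr_lo !(Cr_hi x7) !(Cr_hi y7).
split; apply: (@same_sign_sqr 1).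
- by rewrite quad_det1 -/D; ring.
- by rewrite quad_det2 -/D; ring.
- by rewrite quad_det3 -/D; ring.
Qed.

Lemma sign_triple0 x y z : x \in hi -> y \in hi -> z \in hi ->
  same_sign [:: x; y; z] /\ same_sign [:: 0; 1; 2; x; y; z]%N.
Proof.
move=> xh yh zh.
have x7 : (2 < x < 7)%N by move: xh; rewrite !inE => /or4P[] /eqP ->.
have y7 : (2 < y < 7)%N by move: yh; rewrite !inE => /or4P[] /eqP ->.
have z7 : (2 < z < 7)%N by move: zh; rewrite !inE => /or4P[] /eqP ->.
have -> : same_sign [:: x; y; z] = (sgr (bval (Cr f) [:: x; y; z]) = sgr (tval f
   (false, [:: [:: 0; 1; 2]; [:: 0; 1; 2; x; y; z]]%N))).
  by move: xh yh zh; rewrite !inE => /or4P[] /eqP -> /or4P[] /eqP -> /or4P[] /eqP ->.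
have -> : same_sign [:: 0; 1; 2; x; y; z]%N = (sgr (bval (Cr f) [:: 0; 1; 2; x; y; z]%N) =
   sgr (tval f (false, [:: [:: x; y; z]; [:: x; 1; 2]; [:: y; 1; 2]; [:: z; 1; 2];
     [:: 0; x; 2]; [:: 0; y; 2]; [:: 0; z; 2]; [:: 0; 1; x]; [:: 0; 1; y]; [:: 0; 1; z]]%N))).
  by move: xh yh zh; rewrite !inE => /or4P[] /eqP -> /or4P[] /eqP -> /or4P[] /eqP ->.
rewrite /tval !big_cons !big_nil /bval !Cr_lo !(Cr_hi x7) !(Cr_hi y7) !(Cr_hi z7).
split; [apply: (@same_sign_sqr 1) | apply: (@same_sign_sqr 3)].
- by rewrite quad_det0 -/D; ring.
- by rewrite quad_con0 -/D; ring.
Qed.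

Lemma sign_six : [/\ same_sign (six 2), same_sign (six 1) & same_sign (six 0)].
Proof.
rewrite /same_sign /tval.
rewrite -[crt (six 2)]/(false, [:: six 2; [:: 3; 1; 2]; [:: 4; 1; 2]; [:: 5; 1; 2];
  [:: 6; 1; 2]; [:: 0; 3; 2]; [:: 0; 4; 2]; [:: 0; 5; 2]; [:: 0; 6; 2]])%N.
rewrite -[crt (six 1)]/(false, [:: six 1; [:: 3; 1; 2]; [:: 4; 1; 2]; [:: 5; 1; 2];
  [:: 6; 1; 2]; [:: 0; 1; 3]; [:: 0; 1; 4]; [:: 0; 1; 5]; [:: 0; 1; 6]])%N.
rewrite -[crt (six 0)]/(false, [:: six 0; [:: 0; 3; 2]; [:: 0; 4; 2]; [:: 0; 5; 2];
  [:: 0; 6; 2]; [:: 0; 1; 3]; [:: 0; 1; 4]; [:: 0; 1; 5]; [:: 0; 1; 6]])%N.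
rewrite -[six 0]/[:: 1; 2; 3; 4; 5; 6]%N -[six 1]/[:: 0; 2; 3; 4; 5; 6]%N.
rewrite -[six 2]/[:: 0; 1; 3; 4; 5; 6]%N.
rewrite !big_cons !big_nil /bval !Cr_lo !Cr_hi //.
split; apply: (@same_sign_sqr 4).
- by rewrite quad_con01 -/D; ring.
- by rewrite quad_con02 -/D; ring.
- by rewrite quad_con12 -/D; ring.
Qed.

End Families.

Lemma vars_family : all (fun l => [|| l == [:: 0; 1; 2],
  has (fun x => [|| l == [:: 0; 1; x], l == [:: 0; 2; x] | l == [:: 1; 2; x]]) hi,
  has (fun x => has (fun y =>
    [|| l == [:: 0; x; y], l == [:: 1; x; y] | l == [:: 2; x; y]]) hi) hi,
  has (fun x => has (fun y => has (fun z =>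
    (l == [:: x; y; z]) || (l == [:: 0; 1; 2; x; y; z])) hi) hi) hi |
  [|| l == six 2, l == six 1 | l == six 0]])%N vars.
Proof. by vm_compute. Qed.

Lemma sv_Cr f : typical f -> sv (Cr f) = crs (sv f).
Proof.
move=> /typicalP/sv_noneP fN; rewrite /crs; apply/eq_in_map => l l_v.
rewrite (tsgn_sv f (allP crt_brackets _ l_v)).
have D0 : bval f [:: 0; 1; 2]%N != 0 by apply: fN; vm_compute.
have := allP vars_family _ l_v; rewrite -[_ = _]/(same_sign f l).
case/or4P=> [/eqP->|/hasP[x xh]|/hasP[x xh /hasP[y yh]]|/orP[]].
- by rewrite /same_sign /tval big_cons big_nil /bval !Cr_lo mulr1 mul1r.
- by have [? ? ?] := sign_triple2 f xh; case/or3P=> /eqP ->.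
- by have [? ? ?] := sign_triple1 D0 xh yh; case/or3P=> /eqP ->.
- move=> /hasP[x xh /hasP[y yh /hasP[z zh]]].
  by have [? ?] := sign_triple0 D0 xh yh zh; case/orP=> /eqP ->.
- by have [? ? ?] := sign_six D0; case/or3P=> /eqP ->.
Qed.

Lemma typical_Cr f : typical f -> typical (Cr f).
Proof.
move=> ft; apply/typicalP; rewrite (sv_Cr ft); apply/mapP => -[l l_v].
rewrite (tsgn_sv f (allP crt_brackets _ l_v)) => /esym/eqP; apply/negP; rewrite sgr_neq0.
have /typicalP/sv_noneP fN := ft.
rewrite /tval mulf_neq0 ?signr_eq0 // big_seq prodf_seq_neq0; apply/allP => l' l'_t.
apply/implyP => _; have := allP (allP crt_brackets _ l_v) _ l'_t => /fN.
by rewrite (bval_srt f l') => ?; rewrite mulf_neq0 ?signr_eq0.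
Qed.

Definition Cr_factor f (i : 'I_7) : R := if (i < 3)%N then 1 else
  bval f [:: 0; 1; 2]%N ^+ 3 *
  (bval f [:: nat_of_ord i; 1; 2]%N * bval f [:: 0; nat_of_ord i; 2]%N *
   bval f [:: 0; 1; nat_of_ord i]%N).

Lemma Cr_Cr f : Cr (Cr f) = scale (Cr_factor f) f.
Proof.
apply/funext => i; rewrite {1}/Cr /scale /Cr_factor !Cr_lo /bval inord_val.
case: ltnP => i3; rewrite /Cr; first by rewrite i3 scale1r.
by rewrite ltnNge i3 /= quad_quad.
Qed.

(** The factor is a product of brackets, so its sign can be read off the sign vector. *)
Lemma Cr_factor_lk f i : typical f -> Cr_factor f i != 0 /\
  forall g, sv g = sv f -> sgr (Cr_factor g i) = sgr (Cr_factor f i).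
Proof.
move=> /typicalP/sv_noneP fN; rewrite /Cr_factor; case: ltnP => i3.
  by split=> //; exact: oner_neq0.
have ok l : l \in [:: [:: 0; 1; 2]; [:: nat_of_ord i; 1; 2]; [:: 0; nat_of_ord i; 2];
    [:: 0; 1; nat_of_ord i]]%N -> (srt l).2 \in vars.
  by case: i i3 => -[|[|[|[|[|[|[|]]]]]]] //= ? _; rewrite !inE => /or4P[] /eqP ->; vm_compute.
have nz l : (srt l).2 \in vars -> bval f l != 0.
  by move=> /fN; rewrite (bval_srt f l) => ?; rewrite mulf_neq0 ?signr_eq0.
split=> [|g fg]; first by rewrite !mulf_neq0 ?expf_neq0 // nz // ok // !inE eqxx ?orbT.
have E l : l \in [:: [:: 0; 1; 2]; [:: nat_of_ord i; 1; 2]; [:: 0; nat_of_ord i; 2];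
    [:: 0; 1; nat_of_ord i]]%N -> sgr (bval g l) = sgr (bval f l).
  by move=> /ok l_v; rewrite -!lk_sv // fg.
by rewrite !exprS !expr0 !mulr1 !sgrM !E // !inE eqxx ?orbT.
Qed.

End CremonaSigns.

(** * Paths *)

Section Continuity.
Variables (R : realType) (T : topologicalType).
Implicit Types (r s : T -> R) (a b c x : T -> pt R).
Local Open Scope classical_set_scope.

Lemma continuous_addR r s : continuous r -> continuous s -> continuous (fun t => r t + s t).
Proof. by move=> cr cs t; apply: cvgD; [exact: cr | exact: cs]. Qed.

Lemma continuous_subR r s : continuous r -> continuous s -> continuous (fun t => r t - s t).
Proof. by move=> cr cs t; apply: cvgB; [exact: cr | exact: cs]. Qed.

Lemma continuous_mulR r s : continuous r -> continuous s -> continuous (fun t => r t * s t).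
Proof. by move=> cr cs t; apply: cvgM; [exact: cr | exact: cs]. Qed.

Lemma continuous_add a b : continuous a -> continuous b -> continuous (fun t => a t + b t).
Proof. by move=> ca cb t; apply: cvgD; [exact: ca | exact: cb]. Qed.

Lemma continuous_scale r a : continuous r -> continuous a -> continuous (fun t => r t *: a t).
Proof. by move=> cr ca t; apply: cvgZ; [exact: cr | exact: ca]. Qed.

Lemma continuous_coord a k : continuous a -> continuous (fun t => coord (a t) k).
Proof.
move=> ca t.
apply: (@continuous_comp _ _ _ a (fun M : 'rV[R]_3 => M ord0 (inord k)) t); first exact: ca.
exact: coord_continuous.
Qed.

Lemma continuous_det3 a b c : continuous a -> continuous b -> continuous c ->
  continuous (fun t => det3 (a t) (b t) (c t)).
Proof.
move=> ca cb cc.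
rewrite (_ : (fun t => _) = (fun t =>
  coord (a t) 0 * (coord (b t) 1 * coord (c t) 2 - coord (b t) 2 * coord (c t) 1)
  - coord (a t) 1 * (coord (b t) 0 * coord (c t) 2 - coord (b t) 2 * coord (c t) 0)
  + coord (a t) 2 * (coord (b t) 0 * coord (c t) 1 - coord (b t) 1 * coord (c t) 0))).
  have cM i j : continuous (fun t => coord (b t) i * coord (c t) j).
    by apply: continuous_mulR; exact: continuous_coord.
  have cB i j k l :
      continuous (fun t => coord (b t) i * coord (c t) j - coord (b t) k * coord (c t) l).
    exact: continuous_subR.
  have cA i j k l m : continuous (fun t =>
      coord (a t) m * (coord (b t) i * coord (c t) j - coord (b t) k * coord (c t) l)).
    by apply: continuous_mulR => //; exact: continuous_coord.
  by apply: continuous_addR => //; exact: continuous_subR.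
by apply/funext => t; rewrite det3E.
Qed.

(** The space [T] is arbitrary so that it can also be the subspace [[0, 1]], on which [path_in] asks
    for continuity. *)
Lemma continuous_bval (v : 'I_7 -> T -> pt R) l : (forall i, continuous (v i)) ->
  continuous (fun t => bval (fun i => v i t) l).
Proof.
move=> cv; case: l => [|? [|? [|? [|? [|? [|? [|? ?]]]]]]] /=;
  try by move=> ?; exact: cvg_cst.
  exact: continuous_det3.
apply: continuous_subR; apply: continuous_mulR; apply: continuous_mulR; exact: continuous_det3.
Qed.

End Continuity.

Section Paths.
Variable R : realType.
Implicit Types (f g h : config R) (v : 'I_7 -> R -> pt R).
Local Open Scope classical_set_scope.

Lemma continuous_idR : continuous (fun t : R => t).
Proof. by move=> t; exact: cvg_id. Qed.

Lemma continuous_1subR : continuous (fun t : R => 1 - t).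
Proof. by apply: continuous_subR; [exact: cst_continuous | exact: continuous_idR]. Qed.

Lemma sgr_segment (h : R -> R) : {within [set t : R | 0 <= t <= 1], continuous h} ->
  (forall t, 0 <= t <= 1 -> h t != 0) -> forall t, 0 <= t <= 1 -> sgr (h t) = sgr (h 0).
Proof.
move=> ch h0 t /andP[t0 t1]; apply/eqP; rewrite sgr_eqP ?h0 ?t0 //.
rewrite lt_neqAle eq_sym mulf_neq0 ?h0 ?t0 ?lexx ?ler01 //= leNgt; apply/negP => neg.
have ch' : {within `[0, t], continuous h}.
  apply: (continuous_subspaceW _ ch) => x /=; rewrite in_itv /= => /andP[-> xt].
  exact: le_trans xt t1.
have [] := IVT (v := 0) t0 ch'.
  have [ht|ht] := ltrP 0 (h t).
    have h00 : h 0 < 0 by rewrite -(pmulr_rlt0 _ ht).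
    by rewrite ge_min le_max (ltW h00) (ltW ht) orbT.
  have {}ht : h t < 0 by rewrite lt_neqAle ht h0 ?t0.
  have h00 : 0 < h 0 by rewrite -(nmulr_rlt0 _ ht).
  by rewrite ge_min le_max (ltW h00) (ltW ht) orbT.
move=> x; rewrite in_itv /= => /andP[x0 xt] /eqP; apply/negP/h0.
by rewrite x0 (le_trans xt).
Qed.

Lemma sv_path v : (forall i, {within [set t : R | 0 <= t <= 1], continuous (v i)}) ->
  (forall t, 0 <= t <= 1 -> typical (fun i => v i t)) ->
  forall t, 0 <= t <= 1 -> sv (fun i => v i t) = sv (fun i => v i 0).
Proof.
move=> cv tv t t01; apply/eq_in_map => l l_v.
apply: (@sgr_segment (fun t => bval (fun i => v i t) l)) => // [|u u01].
  by apply: (@continuous_bval R (subspace [set t : R | 0 <= t <= 1])) => i; exact: cv.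
by have /typicalP/sv_noneP := tv u u01; apply.
Qed.

(* Paths with exact end points, not only up to scaling: the quadratic
   transformation depends on the representatives of its three base points. *)
Definition epath (P : config R -> Prop) f g := exists v : 'I_7 -> R -> pt R,
  [/\ forall i, continuous (v i), forall t, 0 <= t <= 1 -> P (fun i => v i t),
      (fun i => v i 0) = f & (fun i => v i 1) = g].

Lemma epath_path P f g : epath P f g -> path_in P f g.
Proof.
move=> [v [cv Pv v0 v1]]; exists v; split=> //.
- by move=> i; exact: continuous_subspaceT.
- by rewrite v0; exact: same_refl.
- by rewrite v1; exact: same_refl.
Qed.

Lemma path_same P f f' g g' : same_config f f' -> same_config g g' ->
  path_in P f g -> path_in P f' g'.
Proof.
move=> ff gg [v [cv Pv v0 v1]]; exists v; split=> //.
- exact: same_trans v0 ff.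
- exact: same_trans v1 gg.
Qed.

Lemma epath_map (P Q : config R -> Prop) (F : config R -> config R) f g :
  (forall h, P h -> Q (F h)) ->
  (forall v, (forall i, continuous (v i)) -> forall i, continuous (fun t => F (v^~ t) i)) ->
  epath P f g -> epath Q (F f) (F g).
Proof.
move=> PQ cF [v [cv Pv <- <-]]; exists (fun i t => F (v^~ t) i); split=> //.
  exact: cF.
by move=> t /Pv/PQ.
Qed.

(** The concatenation is written [v (min (2 t) 1) + w (max (2 t - 1) 0) - v 1], whose continuity is
    plain and requires no gluing at the midpoint. *)
Lemma epath_trans P f g h : epath P f g -> epath P g h -> epath P f h.
Proof.
move=> [v [cv Pv v0 v1]] [w [cw Pw w0 w1]].
have c2 : continuous (fun t : R => 2 * t).
  by apply: continuous_mulR; [exact: cst_continuous | exact: continuous_idR].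
pose m (t : R) : R := Num.min (2 * t) 1; pose M (t : R) : R := Num.max (2 * t - 1) 0.
have cm : continuous m by move=> t; apply: continuous_min; [exact: c2 | exact: cst_continuous].
have cM : continuous M.
  move=> t; apply: (@continuous_max R R (fun t => 2 * t - 1) (fun=> 0)); last exact: cst_continuous.
  by apply: continuous_subR; [exact: c2 | exact: cst_continuous].
have vw i : v i 1 = w i 0 by rewrite -[LHS](congr1 (@^~ i) (esym v1)) -w0.
exists (fun i t => v i (m t) + w i (M t) + (- 1) *: v i 1); split.
- move=> i; apply: continuous_add; last by move=> ?; exact: cst_continuous.
  by apply: continuous_add => t; apply: continuous_comp; [exact: cm|exact: cv|exact: cM|exact: cw].
- move=> t /andP[t0 t1]; have [th|th] := lerP (2 * t) 1.
    have -> : M t = 0 by apply/max_idPr; rewrite subr_le0.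
    have -> : m t = 2 * t by apply/min_idPl.
    rewrite (_ : (fun i => _) = v^~ (2 * t)); last first.
      by apply/funext => i; rewrite -vw scaleN1r addrK.
    by apply: Pv; rewrite th mulr_ge0.
  have -> : M t = 2 * t - 1 by apply/max_idPl; rewrite subr_ge0 ltW.
  have -> : m t = 1 by apply/min_idPr; rewrite ltW.
  rewrite (_ : (fun i => _) = w^~ (2 * t - 1)); last first.
    by apply/funext => i; rewrite scaleN1r addrAC subrr add0r.
  by apply: Pw; lra.
- rewrite -v0; apply/funext => i; rewrite vw /m /M mulr0 sub0r.
  by rewrite min_l ?ler01 // max_r ?lerN10 // scaleN1r addrK.
- rewrite -w1; apply/funext => i; rewrite /m /M mulr1.
  have -> : 2 - 1 = 1 :> R by lra.
  by rewrite min_r ?ler1n // max_l ?ler01 // scaleN1r addrAC subrr add0r.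
Qed.

Lemma epath_segment P f g :
  (forall t, 0 <= t <= 1 -> P (fun i => (1 - t) *: f i + t *: g i)) -> epath P f g.
Proof.
move=> HP; exists (fun i t => (1 - t) *: f i + t *: g i); split=> //.
- move=> i; apply: continuous_add; apply: continuous_scale;
    by [exact: continuous_1subR | exact: cst_continuous | exact: continuous_idR].
- by apply/funext => i; rewrite subr0 scale1r scale0r addr0.
- by apply/funext => i; rewrite subrr scale1r scale0r add0r.
Qed.

End Paths.

(** * Transport of connectedness along relabellings and the quadratic transformation *)

Definition perm_ok (p : seq nat) : bool :=
  perm_eq p (iota 0 7) && all (fun l => (srt [seq nth i p i | i <- l]).2 \in vars) vars.

Definition inverse_of (p : seq nat) : seq nat := [seq index i p | i <- iota 0 7].

Section Transport.
Variable R : realType.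
Implicit Types (f g h : config R) (k : 'I_7 -> R) (p q : seq nat).

Lemma sv_relab p f : perm_ok p -> sv (relab p f) = act p (sv f).
Proof.
move=> /andP[_ /allP p_v]; rewrite /act size_map take_size; apply/eq_in_map => l l_v.
by rewrite bval_relab ?lk_sv ?p_v // (allP vars_lt7).
Qed.

Lemma relabK p q f : all (fun i => nth (nth i q i) p (nth i q i) == i) (iota 0 7) ->
  perm_eq q (iota 0 7) -> relab q (relab p f) = f.
Proof.
move=> /allP pq qi; apply/funext => i; rewrite /relab.
have i7 : (i : nat) \in iota 0 7 by rewrite mem_iota ltn_ord.
have q7 : (nth (i : nat) q i < 7)%N.
  have : nth (i : nat) q i \in q by rewrite mem_nth // (perm_size qi) size_iota.
  by rewrite (perm_mem qi) mem_iota.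
by rewrite inordK // (eqP (pq _ i7)) inord_val.
Qed.

Lemma scaleK k f : (forall i, k i != 0) -> scale (fun i => (k i)^-1) (scale k f) = f.
Proof. by move=> k0; apply/funext => i; rewrite /scale scalerA mulVf ?scale1r. Qed.

Lemma typical_sv f g : sv f = sv g -> typical g -> typical f.
Proof. by move=> fg /typicalP; rewrite -fg => /typicalP. Qed.

Lemma typical_scale k f : (forall i, k i != 0) -> typical f -> typical (scale k f).
Proof. by move=> k0; apply: typical_same; exact: same_scale. Qed.

(** A property of the sign vector of [f] alone. *)
Definition conn f := forall g h, sv g = sv f -> sv h = sv f -> epath (@typical R) g h.

Lemma conn_relab p f : perm_ok p -> perm_ok (inverse_of p) -> typical f ->
  conn f -> conn (relab p f).
Proof.
move=> p_ok q_ok ft cf g h gf hf; set q := inverse_of p in q_ok.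
have [pp _] := andP p_ok; have [qq _] := andP q_ok.
have sz : size p = 7%N by rewrite (perm_size pp) size_iota.
have qE i : (i < 7)%N -> nth i q i = index i p.
  by move=> i7; rewrite /q /inverse_of (nth_map 0%N) ?size_iota // nth_iota.
have qp (e : config R) : relab q (relab p e) = e.
  apply: relabK => //; apply/allP => i; rewrite mem_iota add0n => /= i7.
  have ip : i \in p by rewrite (perm_mem pp) mem_iota.
  by rewrite qE // (set_nth_default 0%N) ?index_mem // nth_index.
have pq (e : config R) : relab p (relab q e) = e.
  apply: relabK => //; apply/allP => i; rewrite mem_iota add0n => /= i7.
  have pi7 : (nth i p i < 7)%N.
    have : nth i p i \in p by rewrite mem_nth ?sz.
    by rewrite (perm_mem pp) mem_iota.
  by rewrite qE // index_uniq ?sz // (perm_uniq pp) iota_uniq.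
rewrite -[g]pq -[h]pq; apply: (@epath_map _ (@typical R)).
- by move=> e; apply: typical_same; exact: (same_relab (n := 7)).
- by move=> v cv i; exact: cv.
- by apply: cf; rewrite (sv_relab _ q_ok) (gf, hf) -(sv_relab _ q_ok) qp.
Qed.

Lemma epath_scale k f g : (forall i, k i != 0) ->
  epath (@typical R) f g -> epath (@typical R) (scale k f) (scale k g).
Proof.
move=> k0; apply: epath_map => [h|v cv i]; first exact: typical_scale.
by apply: continuous_scale => //; exact: cst_continuous.
Qed.

(** The path is multiplied by the linear interpolation between the inverses of [k] and [k'], which
    does not vanish because their signs agree. *)
Lemma epath_rescale k k' f g : (forall i, 0 < k i * k' i) ->
  epath (@typical R) (scale k f) (scale k' g) -> epath (@typical R) f g.
Proof.
move=> kk [v [cv tv v0 v1]].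
pose c i t : R := (1 - t) * (k i)^-1 + t * (k' i)^-1.
have k0 i : k i != 0 by have := kk i; apply: contraTneq => ->; rewrite mul0r ltxx.
have k'0 i : k' i != 0 by have := kk i; apply: contraTneq => ->; rewrite mulr0 ltxx.
exists (fun i t => c i t *: v i t); split.
- move=> i; apply: continuous_scale => //; apply: continuous_addR; apply: continuous_mulR;
    by [exact: continuous_1subR | exact: cst_continuous | exact: continuous_idR].
- move=> t t01; apply: (typical_scale (k := c^~ t)) (tv t t01) => i.
  have : 0 < (k i * k' i) * c i t * k i.
    rewrite /c (_ : _ * _ * _ = (1 - t) * (k i * k' i) + t * k i ^+ 2); last first.
      by field; rewrite k0 k'0.
    have kk2 : 0 < k i ^+ 2 by rewrite exprn_even_gt0 // k0.
    case/andP: t01 => t0 t1.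
    have [->|tn] := eqVneq t 0; first by rewrite subr0 mul1r mul0r addr0.
    apply: ltr_wpDl; first by rewrite mulr_ge0 ?subr_ge0 // ltW.
    by rewrite mulr_gt0 // lt_neqAle eq_sym tn.
  by apply: contraTneq => ->; rewrite mulr0 mul0r ltxx.
- apply/funext => i; rewrite /c subr0 mul1r mul0r addr0 (congr1 (@^~ i) v0) /scale.
  by rewrite scalerA mulVf ?scale1r.
- apply/funext => i; rewrite /c subrr mul1r mul0r add0r (congr1 (@^~ i) v1) /scale.
  by rewrite scalerA mulVf ?scale1r.
Qed.

Lemma continuous_Cr (v : 'I_7 -> R -> pt R) : (forall i, continuous (v i)) ->
  forall i, continuous (fun t => Cr (v^~ t) i).
Proof.
move=> cv i; rewrite /Cr; case: ltnP => _; first exact: cv.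
have cM a b c a' b' c' d : continuous (fun t =>
    (det3 (v a t) (v b t) (v c t) * det3 (v a' t) (v b' t) (v c' t)) *: v d t).
  by apply: continuous_scale => //; apply: continuous_mulR; exact: continuous_det3.
by apply: continuous_add; [apply: continuous_add|].
Qed.

(** The transformation sends realizations [g], [h] of the new sign vector to realizations of the old
    one, up to the factor of [f]. These are joined there, and applying the transformation to that
    path returns to rescaled [g] and [h]. *)
Lemma conn_Cr f : typical f -> conn f -> conn (Cr f).
Proof.
move=> ft cf.
have CrE e : sv e = sv (Cr f) ->
    typical e /\ sv (scale (fun i => (Cr_factor f i)^-1) (Cr e)) = sv f.
  move=> ef; have et : typical e := typical_sv ef (typical_Cr ft).
  have f0 i : Cr_factor f i != 0 by have [] := Cr_factor_lk i ft.
  split=> //; rewrite reor_sv; last by move=> i; rewrite invr_eq0.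
  rewrite (sv_Cr et) ef -(sv_Cr (typical_Cr ft)) Cr_Cr.
  rewrite -(@reor_sv _ (fun i => (Cr_factor f i)^-1)); last by move=> i; rewrite invr_eq0.
  by rewrite scaleK.
move=> g h gf hf; have [gt gE] := CrE g gf; have [ht hE] := CrE h hf.
have := cf _ _ gE hE => /(@epath_scale (Cr_factor f)).
have f0 i : Cr_factor f i != 0 by have [] := Cr_factor_lk i ft.
have sK e : scale (Cr_factor f) (scale (fun i => (Cr_factor f i)^-1) e) = e.
  by apply/funext => i; rewrite /scale scalerA mulfV ?scale1r.
rewrite !sK => /(_ f0) /(epath_map (@typical_Cr R) (@continuous_Cr)); rewrite !Cr_Cr.
(* The factors of [g] and [h] have equal signs, since the two sign vectors agree. *)
apply: epath_rescale => i; have [h0 hi] := Cr_factor_lk i ht.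
by have [g0 _] := Cr_factor_lk i gt; rewrite -sgr_eqP // hi // gf hf.
Qed.

End Transport.

(** * Connectedness of the realizations of one sign vector *)

Section Frames.
Variable R : realType.
Implicit Types (a b c x y z : pt R).

Definition tri a b c : config R :=
  fun i => if i == 0%N :> nat then a else if i == 1%N :> nat then b else c.

Definition pos_frame (f : config R) : Prop := 0 < bval f [:: 0; 1; 2]%N.
Local Notation "a ~~> b" := (epath pos_frame a b) (at level 60).

Lemma bval_tri a b c : bval (tri a b c) [:: 0; 1; 2]%N = det3 a b c.
Proof. by rewrite /bval /tri !inordK. Qed.

Lemma frame_move a b c x : 0 < det3 a b c -> 0 < det3 a b x -> tri a b c ~~> tri a b x.
Proof.
move=> abc abx; apply: epath_segment => t /andP[t0 t1]; rewrite /pos_frame /bval /tri !inordK //=.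
rewrite -!scalerDl subrK !scale1r det3D !det3Zr.
have [->|tn] := eqVneq t 0; first by rewrite subr0 mul1r mul0r addr0.
apply: ltr_wpDl; first by rewrite mulr_ge0 ?subr_ge0 // ltW.
by rewrite mulr_gt0 // lt_neqAle eq_sym tn.
Qed.

Lemma frame_rot a b c x y z : tri a b c ~~> tri x y z -> tri b c a ~~> tri y z x.
Proof.
pose rot (f : config R) : config R := tri (f (inord 1)) (f (inord 2)) (f (inord 0)).
have rotE u v w : rot (tri u v w) = tri v w u by rewrite /rot /tri !inordK.
rewrite -(rotE a b c) -(rotE x y z); apply: epath_map => [f|v cv i].
  by rewrite /pos_frame bval_tri det3_rot.
by rewrite /rot /tri; case: (_ == 0%N); [|case: (_ == 1%N)]; exact: cv.
Qed.

Lemma frame_move0 a b c x : 0 < det3 a b c -> 0 < det3 x b c -> tri a b c ~~> tri x b c.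
Proof. by rewrite -!(det3_rot _ b c) => abc xbc; do 2!apply: frame_rot; exact: frame_move. Qed.

Lemma frame_move1 a b c x : 0 < det3 a b c -> 0 < det3 a x c -> tri a b c ~~> tri a x c.
Proof. by rewrite !(det3_rot c a) => abc axc; apply: frame_rot; exact: frame_move. Qed.

Lemma coordN x k : coord (- x) k = - coord x k.
Proof. by rewrite /coord mxE. Qed.

Lemma det3NN a b c : det3 (- a) (- b) c = det3 a b c.
Proof. by rewrite !det3E !coordN; ring. Qed.

(** A quarter-turn in the plane of [a] and [b], composed of three shears; doing it twice gives the
    half-turn [frame_flip]. *)
Lemma frame_turn a b c : 0 < det3 a b c -> tri a b c ~~> tri (- b) a c.
Proof.
have e1 : det3 (a - b) b c = det3 a b c by rewrite !det3E !coordD !coordN; ring.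
have e2 : det3 (a - b) a c = det3 a b c by rewrite !det3E !coordD !coordN; ring.
have e3 : det3 (- b) a c = det3 a b c by rewrite !det3E !coordN; ring.
move=> abc; apply: (@epath_trans _ _ _ (tri (a - b) b c)).
  by apply: frame_move0; rewrite ?e1.
apply: (@epath_trans _ _ _ (tri (a - b) a c)).
  by apply: frame_move1; rewrite ?e1 ?e2.
by apply: frame_move0; rewrite ?e2 ?e3.
Qed.

Lemma frame_flip a b c : 0 < det3 a b c -> tri a b c ~~> tri (- a) (- b) c.
Proof.
move=> abc; apply: epath_trans (frame_turn abc) _; apply: frame_turn.
by rewrite (_ : det3 _ _ _ = det3 a b c) // !det3E !coordN; ring.
Qed.

(** Positivity of both frames leaves an even number of sign changes: none, or one half-turn. *)
Lemma frame_sign (r s t : bool) a b c : 0 < det3 a b c ->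
  0 < det3 ((-1) ^+ r *: a) ((-1) ^+ s *: b) ((-1) ^+ t *: c) ->
  tri ((-1) ^+ r *: a) ((-1) ^+ s *: b) ((-1) ^+ t *: c) ~~> tri a b c.
Proof.
move=> abc; rewrite det3Z -!signr_addb; case: r s t => [] [] [];
  rewrite /= ?expr1 ?expr0 ?scale1r ?scaleN1r ?mulN1r ?oppr_gt0 ?(lt_gtF abc) // => _.
- rewrite -{2}[a]opprK -{2}[b]opprK; apply: frame_flip.
  by rewrite det3NN.
- rewrite -{2}[a]opprK -{2}[c]opprK; apply: frame_rot; apply: frame_flip.
  by rewrite det3NN -(det3_rot c).
- rewrite -{2}[b]opprK -{2}[c]opprK; do 2!apply: frame_rot; apply: frame_flip.
  by rewrite det3NN det3_rot.
- by apply: frame_move.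
Qed.

Lemma avoid2 a b c x y z : det3 a b c != 0 -> det3 x y z != 0 ->
  exists w, det3 a b w != 0 /\ det3 x y w != 0.
Proof.
move=> abc xyz; have [xyc|xyc] := eqVneq (det3 x y c) 0; last by exists c.
have [abz|abz] := eqVneq (det3 a b z) 0; last by exists z.
by exists (c + z); rewrite !det3D xyc abz addr0 add0r.
Qed.

Lemma sign_choice a b x : det3 a b x != 0 ->
  exists s : bool, 0 < det3 a b ((-1) ^+ s *: x).
Proof.
move=> abx; exists (det3 a b x < 0); rewrite det3Zr.
have [abx0|abx0|/eqP] := ltgtP (det3 a b x) 0; last by rewrite (negbTE abx).
  by rewrite expr1 mulN1r oppr_gt0.
by rewrite mul1r.
Qed.

(** Vectors are exchanged one at a time, by way of auxiliary [w] and [v] outside the planes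
    concerned. Each incoming vector gets the sign that keeps the determinant positive, and
    [frame_sign] removes the signs left at the end. *)
Lemma frames_connected (f g : config R) : pos_frame f -> pos_frame g ->
  exists2 h : config R, (forall i : 'I_7, (i < 3)%N -> h i = g i) & f ~~> h.
Proof.
pose a := f (inord 0); pose b := f (inord 1); pose c := f (inord 2).
pose x := g (inord 0); pose y := g (inord 1); pose z := g (inord 2).
move=> abc xyz; have {}abc : 0 < det3 a b c := abc; have {}xyz : 0 < det3 x y z := xyz.
exists (tri x y z).
  move=> i; rewrite /tri -[in RHS](inord_val i).
  by case: i => -[|[|[|i]]].
have f0 : f ~~> tri a b c.
  apply: epath_segment => t t01; rewrite /pos_frame /bval /tri !inordK //=.
  by rewrite -!scalerDl !subrK !scale1r.
have [w [abw xyw]] := avoid2 (lt0r_neq0 abc) (lt0r_neq0 xyz).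
have [v [wav wxv]] : exists v, det3 w a v != 0 /\ det3 w x v != 0.
  apply: (@avoid2 w a b w x y); by rewrite -det3_rot.
have avw : det3 a v w != 0 by rewrite -(det3_rot w a v) in wav.
have xvw : det3 x v w != 0 by rewrite -(det3_rot w x v) in wxv.
have [t1 abw'] := sign_choice abw; set w' := _ *: w in abw'.
have [t2] : exists s : bool, 0 < det3 w' a ((-1) ^+ s *: v).
  apply: sign_choice; rewrite -det3_rot -[a]scale1r -[v]scale1r det3Z.
  by rewrite !mul1r mulf_neq0 ?signr_eq0.
set v' := _ *: v => wav'; rewrite -det3_rot in wav'.
have [t3] : exists s : bool, 0 < det3 v' w' ((-1) ^+ s *: x).
  apply: sign_choice; rewrite -(det3_rot v' w' x) -(det3_rot w') -[x]scale1r det3Z.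
  by rewrite !mul1r !mulf_neq0 ?signr_eq0.
set x' := _ *: x; rewrite det3_rot => xvw'.
have [t4] : exists s : bool, 0 < det3 w' x' ((-1) ^+ s *: y).
  apply: sign_choice; rewrite -det3_rot -[y]scale1r det3Z.
  by rewrite mulr1 !mulf_neq0 ?signr_eq0.
set y' := _ *: y => wxy'; rewrite -det3_rot in wxy'.
have [t5] : exists s : bool, 0 < det3 x' y' ((-1) ^+ s *: z).
  apply: sign_choice; rewrite -[z]scale1r det3Z mulr1 !mulf_neq0 ?signr_eq0 //.
  exact: lt0r_neq0.
set z' := _ *: z => xyz'.
apply: epath_trans f0 _; apply: epath_trans (frame_move abc abw') _.
apply: epath_trans (frame_move1 abw' wav') _; apply: epath_trans (frame_move0 wav' xvw') _.
apply: epath_trans (frame_move1 xvw' wxy') _; apply: epath_trans (frame_move wxy' xyz') _.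
exact: frame_sign.
Qed.

End Frames.

(** * Moving a point inside a varying triangle *)

Section Triangles.
Variable R : realType.
Implicit Types (f g h : config R) (v : 'I_7 -> R -> pt R).

(* Where the linear forms [det3 p q], [det3 p r], [det3 s u] take values proportional
   to [l1], [l2], [l3]. *)
Definition triangle (p q r s u : pt R) (l1 l2 l3 : R) : pt R :=
  (det3 s u p * l1) *: r + (- (det3 s u p * l2)) *: q
  + (det3 p q r * l3 + l2 * det3 s u q - l1 * det3 s u r) *: p.

Lemma triangle_lines p q r s u l1 l2 l3 : let x := triangle p q r s u l1 l2 l3 in
  let d := det3 p q r * det3 s u p in
  [/\ det3 p q x = d * l1, det3 p r x = d * l2 & det3 s u x = d * l3].
Proof.
split; rewrite /triangle !det3D !det3Zr.
- by rewrite det3aba det3bb; ring.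
- by rewrite det3aba det3bb (det3_swap23 p q r); ring.
- by ring.
Qed.

Lemma triangle_id p q r s u x :
  triangle p q r s u (det3 p q x) (det3 p r x) (det3 s u x) =
  (det3 p q r * det3 s u p) *: x.
Proof.
have Dx := det3_cramer p q r x.
have E : det3 p q r * det3 s u x =
    det3 x q r * det3 s u p + det3 p x r * det3 s u q + det3 p q x * det3 s u r.
  by rewrite -det3Zr Dx !det3D !det3Zr.
rewrite [in RHS]mulrC -[RHS]scalerA Dx !scalerDr !scalerA.
rewrite [RHS]addrC [X in _ = _ + X]addrC addrA /triangle E (det3_swap23 p x r).
by congr (_ *: _ + _ *: _ + _ *: _); ring.
Qed.

Lemma sgr_convex (x y t : R) b : sgr x = Some b -> sgr y = Some b -> 0 <= t <= 1 ->
  sgr ((1 - t) * x + t * y) = Some b.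
Proof.
rewrite {1 2}/sgr; case: eqP => // /eqP x0 [xb]; case: eqP => // /eqP y0 [yb] /andP[t0 t1].
have xy : 0 < x * y by rewrite -sgr_eqP // /sgr (negbTE x0) (negbTE y0) xb yb.
rewrite -xb; suff /eqP : sgr x == sgr ((1 - t) * x + t * y).
  by move=> <-; rewrite /sgr (negbTE x0).
rewrite sgr_eqP // mulrDr mulrCA (mulrCA x t).
have [->|tn] := eqVneq t 0; first by rewrite subr0 mul1r mul0r addr0 -expr2 exprn_even_gt0.
apply: ltr_wpDl; first by rewrite mulr_ge0 ?subr_ge0 // -expr2 sqr_ge0.
by rewrite mulr_gt0 // lt_neqAle eq_sym tn.
Qed.

(** A point is determined by the values of three independent linear forms, and these values are
    interpolated between the two ends, so their signs persist. The two nonvanishing determinants say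
    that the moving lines [pq], [pr], [su] never become concurrent. *)
Lemma triangle_path (p q r s u : R -> pt R) (y z : pt R) (b1 b2 b3 : bool) :
  continuous p -> continuous q -> continuous r -> continuous s -> continuous u ->
  (forall t, 0 <= t <= 1 -> det3 (p t) (q t) (r t) != 0) ->
  (forall t, 0 <= t <= 1 -> det3 (s t) (u t) (p t) != 0) ->
  sgr (det3 (p 0) (q 0) y) = Some b1 -> sgr (det3 (p 1) (q 1) z) = Some b1 ->
  sgr (det3 (p 0) (r 0) y) = Some b2 -> sgr (det3 (p 1) (r 1) z) = Some b2 ->
  sgr (det3 (s 0) (u 0) y) = Some b3 -> sgr (det3 (s 1) (u 1) z) = Some b3 ->
  exists x : R -> pt R, [/\ continuous x,
    forall t, 0 <= t <= 1 -> [/\ sgr (det3 (p t) (q t) (x t)) = Some b1,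
      sgr (det3 (p t) (r t) (x t)) = Some b2 & sgr (det3 (s t) (u t) (x t)) = Some b3],
    exists2 k, 0 < k & x 0 = k *: y & exists2 k, 0 < k & x 1 = k *: z].
Proof.
move=> cp cq cr cs cu D0 E0 y1 z1 y2 z2 y3 z3.
pose D t := det3 (p t) (q t) (r t); pose E t := det3 (s t) (u t) (p t).
pose l (a b : R -> pt R) t := (1 - t) * det3 (a 0) (b 0) y + t * det3 (a 1) (b 1) z.
(* [triangle] attains the values up to the factor [D t * E t], of unknown sign; multiplying by it
   once more makes it a square. *)
pose x t := (D t * E t) *: triangle (p t) (q t) (r t) (s t) (u t) (l p q t) (l p r t) (l s u t).
have cl a b : continuous (l a b).
  apply: continuous_addR; apply: continuous_mulR; by [exact: continuous_1subR
    | exact: cst_continuous | exact: continuous_idR].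
have cM (c d : R -> R) : continuous c -> continuous d -> continuous (fun t => c t * d t).
  exact: continuous_mulR.
have cN (c : R -> R) : continuous c -> continuous (fun t => - c t).
  by move=> cc t; apply: cvgN; exact: cc.
exists x; split.
- apply: continuous_scale; first by apply: cM; exact: continuous_det3.
  apply: continuous_add; first apply: continuous_add; apply: continuous_scale => //.
  + by apply: cM => //; exact: continuous_det3.
  + by apply: cN; apply: cM => //; exact: continuous_det3.
  + apply: continuous_subR; first apply: continuous_addR; apply: cM => //; exact: continuous_det3.
- move=> t t01; rewrite /x !det3Zr.
  have [-> -> ->] := triangle_lines (p t) (q t) (r t) (s t) (u t) (l p q t) (l p r t) (l s u t).
  have DE0 : D t * E t != 0 by rewrite mulf_neq0 ?D0 ?E0.
  rewrite -/(D t) -/(E t) !mulrA -[D t * E t * D t * E t]mulrA -expr2 !sgr_sqr //.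
  by split; apply: sgr_convex.
- exists ((D 0 * E 0) ^+ 2); last first.
    by rewrite /x /l subr0 !mul1r !mul0r !addr0 triangle_id scalerA -expr2.
  by rewrite exprn_even_gt0 //= mulf_neq0 ?D0 ?E0 ?lexx ?ler01.
- exists ((D 1 * E 1) ^+ 2); last first.
    by rewrite /x /l subrr !mul1r !mul0r !add0r triangle_id scalerA -expr2.
  by rewrite exprn_even_gt0 //= mulf_neq0 ?D0 ?E0 ?lexx ?ler01.
Qed.

(** Only the first [n] points are controlled. Their ends are met up to positive factors, which is
    what [triangle_path] provides. *)
Definition partial_path n f g := exists v, [/\ forall i, continuous (v i),
  forall t, 0 <= t <= 1 -> take (nvars n) (sv (v^~ t)) = take (nvars n) s0,
  forall i : 'I_7, (i < n)%N -> exists2 k, 0 < k & v i 0 = k *: f i &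
  forall i : 'I_7, (i < n)%N -> exists2 k, 0 < k & v i 1 = k *: g i].

End Triangles.

Lemma vars_uniq : uniq vars.
Proof. by vm_compute. Qed.

Section Base.
Variable R : realType.
Implicit Types (f g h : config R) (v : 'I_7 -> R -> pt R).

Lemma forced_sv n lines h : (nvars n <= nvars n.+1 <= size vars)%N -> forced n lines ->
  take (nvars n) (sv h) = take (nvars n) s0 ->
  (forall l, l \in lines -> sgr (bval h l) = nth None s0 (index l vars)) ->
  take (nvars n.+1) (sv h) = take (nvars n.+1) s0.
Proof.
move=> /andP[nv1 nv2]; rewrite /forced => /eqP; set cs := [seq _ | i <- _] => E hn hl.
have sz : size cs = (nvars n.+1 - nvars n)%N by rewrite size_map size_iota.
have := @extend_sv R h cs (nvars n) [:: take (nvars n) s0].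
rewrite E sz subnKC // hn => /(_ nv2 _ (mem_head _ _)) H; apply/eqP.
rewrite -mem_seq1; apply: H => i i_lt.
rewrite /cs (nth_map 0%N) ?size_iota // nth_iota //.
have i_v : (nvars n + i < size vars)%N.
  by apply: leq_trans nv2; rewrite -ltn_subRL.
rewrite /sv (nth_map [::]) //; case: ifP => [/hl ->|_].
  by rewrite index_uniq ?vars_uniq ?mem_head.
by case: (sgr _) => [[]|].
Qed.

Lemma sorted_sgr h l : (srt l).2 \in vars -> sgr (bval h l) = lk s0 l ->
  sgr (bval h (srt l).2) = nth None s0 (index (srt l).2 vars).
Proof.
rewrite (bval_srt h l) /lk; case: (srt l) => b m /= _; rewrite sgr_sign.
by case: (sgr _) => [c|]; case: (nth _ _ _) => [d|] //= [] /addbI ->.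
Qed.

Lemma sgr_det3Z k1 k2 (p q x : pt R) : 0 < k1 -> 0 < k2 ->
  sgr (det3 (k1 *: p) (k2 *: q) x) = sgr (det3 p q x).
Proof.
move=> k1p k2p; rewrite -[x in LHS]scale1r det3Z mulr1 !sgrM (sgr_pos k1p) (sgr_pos k2p).
by case: (sgr _).
Qed.

Lemma sgr_Some_neq0 (x : R) b : sgr x = Some b -> x != 0.
Proof. by rewrite /sgr; case: eqP. Qed.

Lemma partial_step n p q r s u f g b b' b1 b2 b3 : (n < 7)%N ->
  (nvars n <= nvars n.+1 <= size vars)%N -> all (all (gtn n)) (take (nvars n) vars) ->
  all (gtn n) [:: p; q; r; s; u] ->
  lk (take (nvars n) s0) [:: p; q; r] = Some b ->
  lk (take (nvars n) s0) [:: s; u; p] = Some b' ->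
  lk s0 [:: p; q; n] = Some b1 -> lk s0 [:: p; r; n] = Some b2 -> lk s0 [:: s; u; n] = Some b3 ->
  {subset [seq (srt l).2 | l <- [:: [:: p; q; n]; [:: p; r; n]; [:: s; u; n]]] <= vars} ->
  forced n [seq (srt l).2 | l <- [:: [:: p; q; n]; [:: p; r; n]; [:: s; u; n]]] ->
  sv f = s0 -> sv g = s0 -> partial_path n f g -> partial_path n.+1 f g.
Proof.
move=> n7 nv vars_n pts_n D0 E0 l1 l2 l3 lv frc ft gt [v [cv sgv v0 v1]].
have [pn qn rn sn un] : [/\ p < n, q < n, r < n, s < n & u < n]%N.
  by case/and5P: pts_n => ? ? ? ? /andP[].
pose P i t := v (inord i) t.
have sgP l c t : lk (take (nvars n) s0) l = Some c -> 0 <= t <= 1 ->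
    bval (v^~ t) l != 0.
  by move=> lE /sgv E; apply: (@sgr_Some_neq0 _ c); apply: (@lk_take_Some _ _ (nvars n)); rewrite E.
have lvp : (srt [:: p; q; n]).2 \in vars by apply: lv; rewrite !inE eqxx.
have lvq : (srt [:: p; r; n]).2 \in vars by apply: lv; rewrite !inE eqxx orbT.
have lvr : (srt [:: s; u; n]).2 \in vars by apply: lv; rewrite !inE eqxx !orbT.
have inordn i : (i < n)%N -> ((inord i : 'I_7) < n)%N.
  by move=> i_n; rewrite inordK // (ltn_trans i_n).
have sg0 i j : (i < n)%N -> (j < n)%N -> (srt [:: i; j; n]).2 \in vars ->
    sgr (det3 (P i 0) (P j 0) (f (inord n))) = lk s0 [:: i; j; n].
  move=> i_n j_n; rewrite -ft => /(lk_sv f) ->; rewrite /P.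
  have [k kp ->] := v0 _ (inordn _ i_n); have [k' kp' ->] := v0 _ (inordn _ j_n).
  by rewrite sgr_det3Z.
have sg1 i j : (i < n)%N -> (j < n)%N -> (srt [:: i; j; n]).2 \in vars ->
    sgr (det3 (P i 1) (P j 1) (g (inord n))) = lk s0 [:: i; j; n].
  move=> i_n j_n; rewrite -gt => /(lk_sv g) ->; rewrite /P.
  have [k kp ->] := v1 _ (inordn _ i_n); have [k' kp' ->] := v1 _ (inordn _ j_n).
  by rewrite sgr_det3Z.
have [x [cx sgx x0 x1]] := @triangle_path R (P p) (P q) (P r) (P s) (P u)
  (f (inord n)) (g (inord n)) b1 b2 b3 (cv _) (cv _) (cv _) (cv _) (cv _)
  (fun t => sgP _ _ _ D0) (fun t => sgP _ _ _ E0)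
  (etrans (sg0 _ _ pn qn lvp) l1) (etrans (sg1 _ _ pn qn lvp) l1)
  (etrans (sg0 _ _ pn rn lvq) l2) (etrans (sg1 _ _ pn rn lvq) l2)
  (etrans (sg0 _ _ sn un lvr) l3) (etrans (sg1 _ _ sn un lvr) l3).
pose w (i : 'I_7) t := if i == n :> nat then x t else v i t.
have wn t : w (inord n) t = x t by rewrite /w inordK ?eqxx.
have wi i t : (i < n)%N -> w (inord i) t = P i t.
  by move=> i_n; rewrite /w inordK ?(ltn_trans i_n) // (ltn_eqF i_n).
exists w; split.
- by move=> i; rewrite /w; case: (_ == _).
- move=> t t01; apply: (forced_sv nv frc).
    rewrite -(sgv t t01) -!map_take; apply/eq_in_map => l l_v; congr sgr.
    have := allP vars_n _ l_v; rewrite /bval.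
    case: l {l_v} => [|c1 [|c2 [|c3 [|c4 [|c5 [|c6 [|? ?]]]]]]] //=.
      by move=> /and4P[? ? ? _]; rewrite !wi.
    by move=> /and5P[? ? ? ? /and3P[? ? _]]; rewrite !wi.
  have [sx1 sx2 sx3] := sgx t t01.
  move=> l'; rewrite !inE => /or3P[] /eqP ->; apply: sorted_sgr => //.
  + by rewrite /bval wn !wi // l1.
  + by rewrite /bval wn !wi // l2.
  + by rewrite /bval wn !wi // l3.
- move=> i; rewrite ltnS leq_eqVlt /w => /predU1P[i_n|i_n].
    by rewrite i_n eqxx; have [k kp E] := x0; exists k => //; rewrite E -i_n inord_val.
  by rewrite (ltn_eqF i_n); exact: v0.
- move=> i; rewrite ltnS leq_eqVlt /w => /predU1P[i_n|i_n].
    by rewrite i_n eqxx; have [k kp E] := x1; exists k => //; rewrite E -i_n inord_val.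
  by rewrite (ltn_eqF i_n); exact: v1.
Qed.

Definition step_ok n (p q r s u : nat) : bool :=
  let ls := [:: [:: p; q; n]; [:: p; r; n]; [:: s; u; n]] in
  [&& n < 7, nvars n <= nvars n.+1 <= size vars, all (all (gtn n)) (take (nvars n) vars),
      all (gtn n) [:: p; q; r; s; u],
      all (fun l => lk (take (nvars n) s0) l != None) [:: [:: p; q; r]; [:: s; u; p]],
      all (fun l => lk s0 l != None) ls, all (fun l => l \in vars) [seq (srt l).2 | l <- ls] &
      forced n [seq (srt l).2 | l <- ls]]%N.

Lemma partial_step_ok n p q r s u f g : step_ok n p q r s u ->
  sv f = s0 -> sv g = s0 -> partial_path n f g -> partial_path n.+1 f g.
Proof.
case/and5P=> n7 nv vars_n pts_n /and4P[/and3P[]].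
case D0: (lk _ [:: p; q; r]) => [b|//] _; case E0: (lk _ [:: s; u; p]) => [b'|//] _ _.
case/and4P; case l1: (lk _ [:: p; q; n]) => [b1|//] _.
case l2: (lk _ [:: p; r; n]) => [b2|//] _; case l3: (lk _ [:: s; u; n]) => [b3|//] _ _.
by move=> /allP lv frc; apply: (partial_step n7 nv vars_n pts_n D0 E0 l1 l2 l3 lv frc).
Qed.

Lemma partial_path3 f g : sv f = s0 -> sv g = s0 -> partial_path 3 f g.
Proof.
have pos_s0 h : sv h = s0 -> pos_frame h.
  move=> hs; have : sgr (bval h [:: 0; 1; 2]%N) = pos.
    rewrite -lk_sv; last by vm_compute.
    by rewrite hs; vm_compute.
  rewrite /pos_frame /sgr; case: eqP => // /eqP h0 [] /negbT.
  by rewrite -leNgt lt_neqAle eq_sym h0.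
move=> /pos_s0 fp /pos_s0 gp; have [h hg [v [cv vp v0 v1]]] := frames_connected fp gp.
exists v; split=> //.
- move=> t t01; have := vp t t01; rewrite /pos_frame => /sgr_pos E.
  rewrite (_ : take _ s0 = [:: pos]); last by vm_compute.
  by rewrite -map_take (_ : take _ vars = [:: [:: 0; 1; 2]%N]); [rewrite /= E | vm_compute].
- by move=> i _; exists 1; rewrite ?ltr01 // scale1r (congr1 (@^~ i) v0).
- by move=> i i3; exists 1; rewrite ?ltr01 // scale1r (congr1 (@^~ i) v1) hg.
Qed.

Lemma typical_s0 f : sv f = s0 -> typical f.
Proof. by move=> fs; apply/typicalP; rewrite fs; vm_compute. Qed.

Lemma steps_ok : [/\ step_ok 3 0 1 2 1 2, step_ok 4 1 0 3 2 3, step_ok 5 0 1 4 1 2 &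
  step_ok 6 0 2 3 1 5]%N.
Proof. by vm_compute. Qed.

Lemma partial_path7 f g : sv f = s0 -> sv g = s0 -> partial_path 7 f g.
Proof.
move=> fs gs; have [ok3 ok4 ok5 ok6] := steps_ok; have p3 := partial_path3 fs gs.
have p4 := partial_step_ok ok3 fs gs p3; have p5 := partial_step_ok ok4 fs gs p4.
exact: partial_step_ok ok6 fs gs (partial_step_ok ok5 fs gs p5).
Qed.

Lemma s0_connected f g : sv f = s0 -> sv g = s0 -> epath (@typical R) f g.
Proof.
move=> fs gs; have [v [cv sgv v0 v1]] := partial_path7 fs gs.
have /choice[k kP] : forall i, exists k, 0 < k /\ v i 0 = k *: f i.
  by move=> i; have [k k0 E] := v0 i (ltn_ord i); exists k.
have /choice[k' kP'] : forall i, exists k, 0 < k /\ v i 1 = k *: g i.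
  by move=> i; have [k' k0 E] := v1 i (ltn_ord i); exists k'.
apply: (@epath_rescale _ k k') => [i|].
  by rewrite mulr_gt0 //; [have [] := kP i | have [] := kP' i].
exists v; split=> //.
- move=> t t01; apply: typical_s0; rewrite -[LHS]take_nvars7 (sgv t t01) -fs.
  exact: take_nvars7.
- by apply/funext => i; have [] := kP i.
- by apply/funext => i; have [] := kP' i.
Qed.

End Base.

(** * Derivative codes *)

Lemma combs2_ok : all (fun o => all (fun i => all (fun j =>
  let B := without [:: i; j] (without [:: o] pts) in
  all (fun rt => [&& size rt == 2, nth 0 rt 0 \in B, nth 0 rt 1 \in B &
     nth 0 rt 0 != nth 0 rt 1]) (combs 2 B) &&
  all (fun r => all (fun t => [|| r == t, [:: r; t] \in combs 2 B | [:: t; r] \in combs 2 B])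
    B) B) pts) pts) pts.
Proof. by vm_compute. Qed.

Section Adjacency.
Variable R : realType.
Implicit Types (f g h : config R) (A : {set 'I_7}).

(** With [P] and [Q] the values of the line at the end points, a meeting point is a nonnegative
    nonzero solution of [a * P + sg * b * Q = 0]. It exists iff the two coefficients have opposite
    signs, and then [|Q|], [|P|] is one. *)
Lemma seg_meetsP (p q r s : pt R) (sg : R) :
  det3 r s p != 0 -> det3 r s q != 0 -> sg = 1 \/ sg = -1 ->
  seg_meets_line p q r s sg <-> ~ 0 < sg * (det3 r s p * det3 r s q).
Proof.
move=> P0 Q0 sg1; set P := det3 r s p in P0 *; set Q := det3 r s q in Q0 *.
have det_sum (a b : R) : det3 r s (a *: p + (sg * b) *: q) = a * P + sg * b * Q.
  by rewrite det3D !det3Zr.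
split.
  move=> [a [b [a0 b0 ab]]]; rewrite det_sum => E pos.
  have E2 : a * P ^+ 2 + b * (sg * (P * Q)) = 0 by rewrite -(mulr0 P) -E; ring.
  have P2 : 0 < P ^+ 2 by rewrite exprn_even_gt0 // P0.
  have t1 : 0 <= a * P ^+ 2 by rewrite mulr_ge0 // ltW.
  have t2 : 0 <= b * (sg * (P * Q)) by rewrite mulr_ge0 // ltW.
  have : a * P ^+ 2 == 0 by rewrite eq_le t1 andbT -E2 lerDl.
  have : b * (sg * (P * Q)) == 0 by rewrite eq_le t2 andbT -E2 lerDr.
  rewrite mulf_eq0 (gt_eqF pos) orbF => b00; rewrite mulf_eq0 (gt_eqF P2) orbF => a00.
  by move: ab; rewrite a00 b00.
move=> /negP; rewrite -leNgt => neg.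
exists `|Q|, `|P|; split; rewrite ?normr_ge0 ?normr_eq0 ?Q0 // det_sum.
move: neg; case: (ltrgt0P P) P0 => // P1 _; case: (ltrgt0P Q) Q0 => // Q1 _;
  case: sg1 => ->; rewrite ?mul1r ?mulN1r => H; first [by ring | exfalso; nra].
Qed.

Definition side f (i j r t : 'I_7) : R :=
  det3 (f r) (f t) (f i) * det3 (f r) (f t) (f j).

Lemma adj_relP f A i j : typical f -> reflect
  [/\ i \in A, j \in A, i != j & exists b : bool, forall r t, r \in A -> t \in A -> r != t ->
     r \notin [set i; j] -> t \notin [set i; j] -> sgr (side f i j r t) = Some b]
  (adj_rel f A i j).
Proof.
move=> ft; have fN := (typicalP f).1 ft.
have nz r t : r != t -> r \notin [set i; j] -> t \notin [set i; j] ->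
    det3 (f r) (f t) (f i) != 0 /\ det3 (f r) (f t) (f j) != 0.
  by rewrite !inE !negb_or => rt /andP[ri rj] /andP[ti tj]; split; apply: bval_triple_neq0.
apply: (iffP (asboolP _)) => -[iA jA ij].
  move=> [sg [sg1 H]]; split=> //; exists (sg < 0) => r t rA tA rt rij tij.
  have [p0 q0] := nz r t rt rij tij.
  have := H r t rA tA rt rij tij; rewrite (seg_meetsP p0 q0 sg1) => /contrapT.
  rewrite -/(side f i j r t); case: sg1 => ->.
    by rewrite mul1r ltr10 => /sgr_pos.
  rewrite mulN1r oppr_gt0 ltrN10 => neg.
  by rewrite /sgr (lt_eqF neg) neg.
move=> [b H]; split=> //; exists (if b then -1 else 1); split; first by case: b {H}; [right|left].
move=> r t rA tA rt rij tij; have [p0 q0] := nz r t rt rij tij.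
rewrite (seg_meetsP p0 q0); last by case: b {H}; [right|left].
apply; have := H r t rA tA rt rij tij; rewrite -/(side f i j r t) /sgr.
case: eqP => // /eqP s0_ [] <-; have [neg|pos] := ltrP (side f i j r t) 0.
  by rewrite mulN1r oppr_gt0.
by rewrite mul1r lt_neqAle eq_sym s0_.
Qed.

Lemma adj_rel_sym A f : typical f -> symmetric (adj_rel f A).
Proof.
move=> ft i j; apply/(adj_relP _ _ _ ft)/(adj_relP _ _ _ ft) => -[iA jA ij [b H]];
  (split=> //; first by rewrite eq_sym); exists b => r t rA tA rt;
  by rewrite finset.setUC => rij tij; rewrite /side mulrC; exact: H.
Qed.

Lemma adj_sv f (m i j : 'I_7) : typical f ->
  adj_rel f [set~ m] i j = adjS (sv f) (without [:: (m : nat)] pts) i j.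
Proof.
move=> ft; have fN := (typicalP f).1 ft.
have memA (x : 'I_7) : (x \in [set~ m]) = ((x : nat) \in without [:: (m : nat)] pts).
  by rewrite in_setC1 mem_filter mem_pts ltn_ord andbT inE.
have memB (x : 'I_7) : (x \in [set~ m]) && (x \notin [set i; j]) =
    ((x : nat) \in without [:: (i : nat); (j : nat)] (without [:: (m : nat)] pts)).
  by rewrite [in RHS]mem_filter -memA !inE andbC.
have ltB x : x \in without [:: (i : nat); (j : nat)] (without [:: (m : nat)] pts) -> (x < 7)%N.
  by rewrite !mem_filter mem_pts => /and3P[].
have := allP (allP (allP combs2_ok m _) i _) j _.
rewrite !mem_pts => /(_ (ltn_ord _) (ltn_ord _) (ltn_ord _)).
rewrite /adjS; set B := without _ (without _ _) in memB ltB *; set As := without _ _ in memA *.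
move=> /andP[/allP cB /allP Bc].
have sideE (r t : 'I_7) : r != t -> (r : nat) \in B -> (t : nat) \in B ->
    mulo (lk (sv f) ([:: (r : nat); (t : nat)] ++ [:: (i : nat)]))
         (lk (sv f) ([:: (r : nat); (t : nat)] ++ [:: (j : nat)])) = sgr (side f i j r t).
  move=> rt; rewrite -!memB !inE !negb_or => /and3P[_ ri rj] /and3P[_ ti tj].
  have ok (x y z : 'I_7) : x != y -> y != z -> x != z ->
      (srt [:: (x : nat); (y : nat); (z : nat)]).2 \in vars.
    move=> xy yz xz; have := allP (allP (allP triples_vars x _) y _) z _.
    rewrite !mem_pts => /(_ (ltn_ord _) (ltn_ord _) (ltn_ord _)).
    by rewrite !val_eqE (negbTE xy) (negbTE yz) (negbTE xz).
  rewrite !lk_sv ?ok // -sgrM /side /bval /= !inord_val //.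
have allE c : all (pred1 (Some c)) [seq mulo (lk (sv f) (rt ++ [:: (i : nat)]))
      (lk (sv f) (rt ++ [:: (j : nat)])) | rt <- combs 2 B] <->
    forall r t : 'I_7, (r : nat) \in B -> (t : nat) \in B -> r != t ->
      sgr (side f i j r t) = Some c.
  rewrite all_map; split=> [/allP H r t rB tB rt|H].
    have := allP (Bc _ rB) _ tB; rewrite -val_eqE in rt; rewrite (negbTE rt) /= => /orP[] /H /= /eqP.
      by rewrite sideE.
    rewrite sideE // 1?eq_sym // => <-.
    by rewrite /side !(det3_swap12 (f r) (f t)) mulrNN.
  apply/allP => rt /[dup] rt_c /cB /and4P[]; case: rt rt_c => [|r [|t [|? ?]]] // _ _ /= rB tB rt.
  have rE : r = (inord r : 'I_7) :> nat by rewrite inordK ?ltB.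
  have tE : t = (inord t : 'I_7) :> nat by rewrite inordK ?ltB.
  have rt' : (inord r : 'I_7) != inord t by rewrite -val_eqE /= -rE -tE.
  rewrite /= rE tE [X in X == _](sideE (inord r) (inord t)) -?rE -?tE //.
  by rewrite H // -?rE -?tE.
apply/(adj_relP _ _ _ ft)/idP => [[iA jA ij [b H]]|].
  rewrite -!memA iA jA ij /=.
  suff : all (pred1 (Some b)) [seq mulo (lk (sv f) (rt ++ [:: (i : nat)]))
      (lk (sv f) (rt ++ [:: (j : nat)])) | rt <- combs 2 B] by case: b {H} => ->; rewrite ?orbT.
  by apply/allE => r t; rewrite -!memB => /andP[rA rij] /andP[tA tij] rt; apply: H.
rewrite -!memA; case: ifP => // /and3P[iA jA ij] H; split=> //.
have [b Hb] : exists b, all (pred1 (Some b)) [seq mulo (lk (sv f) (rt ++ [:: (i : nat)]))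
      (lk (sv f) (rt ++ [:: (j : nat)])) | rt <- combs 2 B].
  by case/orP: H => H; eexists; exact: H.
by exists b => r t rA tA rt rij tij; apply: (allE b).1 => //; rewrite -memB ?rA ?tA.
Qed.

End Adjacency.

Section Components.

Lemma card_ord7 (P : pred nat) : #|[pred i : 'I_7 | P i]| = count P pts.
Proof.
rewrite cardE /enum_mem size_filter -[pts](val_enum_ord 7) count_map enumT.
by apply: eq_count => i; rewrite !inE.
Qed.

Variables (e : rel 'I_7) (A : {set 'I_7}) (c : 'I_7 -> 'I_7).
Hypotheses (e_sym : symmetric e) (eA : forall i j, e i j -> i \in A)
  (ec : forall i j, e i j -> c i = c j) (cA : forall i, i \in A -> c i \in A)
  (cc : forall i, i \in A -> c (c i) = c i) (c_conn : forall i, connect e i (c i)).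

(** Both sides count a transversal of the components: on the roots [c] is injective, with image the
    fixed points of [c] in [A]. *)
Lemma n_comp_labels : n_comp e (mem A) = #|[pred i in A | c i == i]|.
Proof.
have conn_c i j : connect e i j -> c i = c j.
  move=> /connectP[p]; elim: p i => [|k p IHp] i /=; first by move=> _ ->.
  by move=> /andP[/ec ->]; exact: IHp.
have sym := sym_connect_sym e_sym.
have clA : fingraph.closed e (mem A).
  by move=> i j ij; rewrite (eA ij) (eA (i := j) (j := i)) // e_sym.
have rc i j : c i = c j -> fingraph.root e i = fingraph.root e j.
  by move=> cij; apply/(fingraph.rootP sym); apply: connect_trans (c_conn i) _; rewrite cij sym.
rewrite /n_comp_mem.
rewrite -(card_in_imset (f := c)); last first.
  move=> i j; rewrite !inE => /andP[/eqP ri _] /andP[/eqP rj _] cij.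
  by rewrite -ri -rj; exact: rc.
apply: eq_card => i; apply/imsetP/idP => [[j]|]; rewrite !inE.
  by move=> /andP[_ jA] ->; rewrite cA //= cc.
move=> /andP[iA /eqP ci]; exists (fingraph.root e i).
  rewrite !inE (roots_root sym) /=.
  by rewrite -(closed_connect clA (connect_root e i)).
by rewrite -(conn_c i) // connect_root.
Qed.

End Components.

Lemma congr4 (T : Type) (a b c d a' b' c' d' : T) :
  a = a' -> b = b' -> c = c' -> d = d' -> (a, b, c, d) = (a', b', c', d').
Proof. by move=> -> -> -> ->. Qed.

Section Codes.
Variable R : realType.
Implicit Types (f g h : config R).

(** Every round keeps the label of a point in its component, and [labels_ok] makes labels constant
    on components, so self-labelled points count them. *)
Lemma delta_sv f (m : 'I_7) : typical f -> labels_ok (sv f) (without [:: (m : nat)] pts) ->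
  delta f m = deltaS (sv f) m.
Proof.
move=> ft; rewrite /delta /ncomp_adj /deltaS; set s := sv f; set As := without _ _.
have memA (x : 'I_7) : (x \in [set~ m]) = ((x : nat) \in As).
  by rewrite in_setC1 mem_filter mem_pts ltn_ord andbT inE.
have ltA i : i \in As -> (i < 7)%N by rewrite mem_filter mem_pts => /andP[].
pose e := adj_rel f [set~ m]; rewrite -/e.
have eE i j : e i j = adjS s As i j by exact: adj_sv.
have eA i j : e i j -> (i \in [set~ m]) && (j \in [set~ m]).
  by move=> /(adj_relP _ _ _ ft)[-> ->].
have conn (i : 'I_7) : (nth 0%N (labels s As) i < 7)%N /\
    connect e i (inord (nth 0%N (labels s As) i)).
  rewrite /labels; set nb := [seq [seq j <- _ | _] | i <- _].
  set step := (F in iter 6 F _).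
  suff H n : forall i : 'I_7, (nth 0%N (iter n step pts) i < 7)%N /\
      connect e i (inord (nth 0%N (iter n step pts) i)) by exact: H.
  elim: n => [|n IHn] {}i.
    by rewrite /= [nth _ _ _](nth_iota 0%N 0 (ltn_ord i)) inord_val ltn_ord connect0.
  rewrite iterS; set c := iter n _ pts in IHn *.
  rewrite (nth_map 0%N) ?size_iota // nth_iota // add0n (nth_map 0%N) ?size_iota // nth_iota // add0n.
  (* The minimum is the label of [i] or of a neighbour [h], so it stays reachable from [i]. *)
  have [h hs ->] : exists2 h : 'I_7, (h == i) || e i h &
      foldr minn (nth 0%N c i) [seq nth 0%N c j | j <- pts & adjS s As i j] = nth 0%N c h.
    have : all (gtn 7) pts by [].
    elim: pts => [|j l IHl] /=; first by exists i; rewrite ?eqxx.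
    move=> /andP[j7 /IHl[h hs hE]]; case: ifP => ij; last by exists h.
    rewrite /= hE; case: leqP => _; last by exists h.
    by exists (Ordinal j7) => //; rewrite eE ij orbT.
  have [h7 hc] := IHn h; split=> //.
  by case/predU1P: hs => [<-//|/connect1 eh]; exact: connect_trans hc.
move=> /allP lab; pose c (i : 'I_7) : 'I_7 := inord (nth 0%N (labels s As) i).
have cE i : c i = nth 0%N (labels s As) i :> nat by rewrite inordK //; have [] := conn i.
have lab3 (i j : 'I_7) : e i j -> (c j == c i) && e j i.
  move=> ij; have /andP[iA jA] := eA i j ij; rewrite !memA in iA jA.
  have /and3P[_ _ /allP/(_ _ jA)] := lab _ iA.
  by rewrite -[adjS s As i j]eE ij -eE -val_eqE /= !cE.
rewrite (@n_comp_labels e [set~ m] c).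
- have -> : #|[pred i in [set~ m] | c i == i]| =
      count (fun i => (i \in As) && (nth 0%N (labels s As) i == i)) pts.
    by rewrite -card_ord7; apply: eq_card => i; rewrite [LHS]inE [RHS]inE -memA -cE val_eqE.
  rewrite [in RHS]/As /without count_filter; apply: eq_in_count => i i7 /=.
  by rewrite mem_filter i7 andbT andbC.
- by move=> i j; apply/idP/idP => /lab3/andP[].
- by move=> i j /eA/andP[].
- by move=> i j /lab3/andP[/eqP].
- by move=> i; rewrite !memA cE => /lab/and3P[].
- move=> i; rewrite memA => /lab/and3P[_ /eqP E _].
  by apply/val_inj; rewrite /= !cE.
- by move=> i; have [] := conn i.
Qed.

Lemma deriv_code_sv f : typical f -> codes_ok (sv f) -> deriv_code f = codeS (sv f).
Proof.
move=> ft /allP ok.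
have dE m : delta f m = deltaS (sv f) m.
  by apply: delta_sv => //; apply: ok; rewrite mem_pts.
have cE k : #|[set m | delta f m == k]| = count_mem k [seq deltaS (sv f) i | i <- pts].
  by rewrite count_map -card_ord7; apply: eq_card => m; rewrite !inE dE.
by rewrite /deriv_code !cE.
Qed.

(** Up to squares, rescaling multiplies every [side] of the pair [i, j] by [k i * k j], whatever the
    separating line; so whether all the signs agree does not change. *)
Lemma deriv_code_same f g : typical f -> same_config g f -> deriv_code g = deriv_code f.
Proof.
move=> ft gf; have gt := typical_same gf ft.
have [s [k k0 gE]] := (same_configP g f).1 gf.
have adjE A i j : adj_rel g A i j = adj_rel f (s @: A) (s i) (s j).
  have sideE r t : side g i j r t =
      (k r * k t) ^+ 2 * (k i * k j) * side f (s i) (s j) (s r) (s t).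
    by rewrite gE /side /scale !det3Z; ring.
  have inj := @perm_inj _ s.
  have kij : k i * k j != 0 by rewrite mulf_neq0.
  have sg r t b : sgr (side g i j r t) = Some b <->
      sgr (side f (s i) (s j) (s r) (s t)) = Some (b (+) (k i * k j < 0)).
    rewrite sideE -mulrA sgr_sqr ?mulf_neq0 // sgrM [sgr (k i * k j)]/sgr (negbTE kij).
    by case: (sgr _) => [c|] //=; case: (k i * k j < 0); case: c b => [] []; split.
  have sset x y z : (s x \in [set s y; s z]) = (x \in [set y; z]).
    by rewrite !inE !(inj_eq inj).
  apply/(adj_relP _ _ _ gt)/(adj_relP _ _ _ ft); rewrite !(mem_imset _ _ inj) (inj_eq inj).
    move=> [iA jA ij [b H]]; split=> //; exists (b (+) (k i * k j < 0)).
    move=> _ _ /imsetP[r rA ->] /imsetP[t tA ->]; rewrite (inj_eq inj) !sset => rt rij tij.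
    by apply/sg; exact: H.
  move=> [iA jA ij [b H]]; split=> //; exists (b (+) (k i * k j < 0)) => r t rA tA rt rij tij.
  by apply/sg; rewrite addbK; apply: H; rewrite ?sset ?(mem_imset _ _ inj) ?(inj_eq inj).
have deltaE m : delta g m = delta f (s m).
  rewrite /delta /ncomp_adj; have sA : s @: [set~ m] = [set~ s m].
    apply/setP => x; rewrite -[x](permKV s) (mem_imset _ _ (@perm_inj _ s)) !in_setC1.
    by rewrite (inj_eq (@perm_inj _ s)).
  set e := adj_rel f [set~ s m]; set e' := adj_rel g [set~ m].
  have cl : fingraph.closed e (mem [set~ s m]).
    by move=> i j /(adj_relP _ _ _ ft)[-> ->].
  have sym := sym_connect_sym (adj_rel_sym [set~ s m] ft).
  have sym' := sym_connect_sym (adj_rel_sym [set~ m] gt).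
  have adj : @rel_adjunction_mem _ _ s e e' (mem [set~ s m]).
    apply: strict_adjunction => //; first exact: perm_inj.
      by apply/fintype.subsetP => x _; apply/codomP; exists (s^-1 x)%g; rewrite permKV.
    by move=> i j _; rewrite /e /e' adjE sA.
  rewrite (adjunction_n_comp s sym sym' cl adj); apply: eq_n_comp_r => i.
  by rewrite !inE (inj_eq (@perm_inj _ s)).
have cE (F G : 'I_7 -> nat) : (forall m, F m = G (s m)) ->
    forall n, #|[set m | F m == n]| = #|[set m | G m == n]|.
  move=> FG n; have <- : s @: [set m | F m == n] = [set m | G m == n].
    apply/setP => x; rewrite -[x](permKV s) (mem_imset _ _ (@perm_inj _ s)) !inE.
    by rewrite FG.
  by apply/esym/card_imset; exact: perm_inj.
exact: congr4 (cE _ _ deltaE 1%N) (cE _ _ deltaE 2%N) (cE _ _ deltaE 3%N) (cE _ _ deltaE 6%N).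
Qed.

End Codes.

(** * Components *)

Definition codes : seq (nat * nat * nat * nat) :=
  [:: (0, 6, 1, 0); (0, 4, 3, 0); (3, 4, 0, 0); (2, 2, 3, 0); (7, 0, 0, 0); (1, 4, 2, 0);
      (0, 3, 3, 1); (1, 0, 6, 0); (1, 6, 0, 0); (2, 2, 3, 0); (1, 2, 2, 2); (3, 4, 0, 0);
      (1, 2, 4, 0); (2, 2, 3, 0)]%N.

Lemma codes_classes : map codeS classes = codes.
Proof. by vm_compute. Qed.

Lemma codes_ok_classes : all codes_ok classes.
Proof. by vm_compute. Qed.

Fixpoint tree_ok n (tr : seq (nat * seq nat)) : bool :=
  if tr is (j, p) :: tr' then
    [&& (j < n)%N, perm_ok p, perm_ok (inverse_of p) & tree_ok n.+1 tr'] else true.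

Lemma tree_is_ok : tree_ok 1 tree.
Proof. by vm_compute. Qed.

(* Unlike [has], stops at the first success also under call by value. *)
Fixpoint some (T : Type) (a : T -> bool) (l : seq T) : bool :=
  if l is x :: l' then if a x then true else some a l' else false.

Fixpoint bits n : seq bitseq :=
  if n is n'.+1 then [seq b :: l | b <- [:: false; true], l <- bits n'] else [:: [::]].

Definition flip (e : bitseq) (l : bracket) : bool :=
  (size l == 3%N) && foldr (fun i b => nth false e i (+) b) false l.

Definition mismatch (s t : seq sgn) e p l : bool :=
  if lk s [seq nth i p i | i <- l] is Some b then
    if nth None t (index l vars) is Some c then flip e l (+) b != c else false
  else false.

(* No relabelling and reorientation turns [s] into [t]; the conics, which do not
   feel the reorientation, exclude most relabellings. *)
Definition apart (s t : seq sgn) : bool :=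
  all (fun p => if some (mismatch s t [::] p) [seq six i | i <- pts] then true
      else all (fun e => some (mismatch s t e p) vars) (bits 7))
    (permutations pts).

(** Only four pairs of classes share a code: one pair for (3, 4, 0, 0) and three for (2, 2, 3,
    0). *)
Lemma classes_apart : all (fun i => all (fun j =>
    if (i < j)%N && (nth (0, 0, 0, 0) codes i == nth (0, 0, 0, 0) codes j) then
      apart (nth [::] classes i) (nth [::] classes j) else true)
  (iota 0 14)) (iota 0 14).
Proof. by vm_compute. Qed.

Lemma some_has (T : eqType) (a : T -> bool) (l : seq T) : some a l -> exists2 x, x \in l & a x.
Proof.
elim: l => //= x l IHl; case: ifP => [ax _|_ /IHl[y yl ay]].
  by exists x; rewrite ?mem_head.
by exists y; rewrite // inE yl orbT.
Qed.

Lemma mem_bits (e : bitseq) : e \in bits (size e).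
Proof.
elim: e => [|b e IHe] //=; rewrite mem_cat; case: b; rewrite ?cats0; apply/orP; [right|left];
  by rewrite ?cats0; apply/mapP; exists e.
Qed.

(** * Representatives of the fourteen classes *)

Section Representatives.
Variable R : realType.
Implicit Types (f g h : config R).

Definition base_points : seq (seq int) :=
  [:: [:: 1; 0; 0]; [:: 0; 1; 0]; [:: 0; 0; 1]; [:: 1; -1; 1]; [:: 2; -3; 1];
      [:: -1; -4; 1]; [:: -4; -2; 3]].

Definition base_config : config R :=
  fun i => \row_(j < 3) (nth 0 (nth [::] base_points i) j)%:~R.

(** The signs are computed over the integers, where they can be evaluated, and carried to [R] by the
    ring morphism. *)
Definition det_int (a b c : seq int) : int :=
  let x u k := nth 0 u k in
  x a 0%N * (x b 1%N * x c 2%N - x b 2%N * x c 1%N)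
  - x a 1%N * (x b 0%N * x c 2%N - x b 2%N * x c 0%N)
  + x a 2%N * (x b 0%N * x c 1%N - x b 1%N * x c 0%N).

Definition bval_int (l : bracket) : int :=
  let d i j k := det_int (nth [::] base_points i) (nth [::] base_points j)
    (nth [::] base_points k) in
  match l with
  | [:: a; b; c] => d a b c
  | [:: a; b; c; d'; e; f] =>
      d a b e * d c d' e * (d a c f * d b d' f) - d a b f * d c d' f * (d a c e * d b d' e)
  | _ => 0
  end.

Lemma sv_base : sv base_config = s0.
Proof.
have dE i j k : (i < 7)%N -> (j < 7)%N -> (k < 7)%N ->
    det3 (base_config (inord i)) (base_config (inord j)) (base_config (inord k)) =
    (det_int (nth [::] base_points i) (nth [::] base_points j) (nth [::] base_points k))%:~R.
  move=> i7 j7 k7; rewrite det3E /coord !mxE !inordK // /det_int.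
  by rewrite !(rmorphD, rmorphB, rmorphM, rmorphN).
have -> : s0 = [seq (if bval_int l == 0 then None else Some (bval_int l < 0)) | l <- vars].
  by vm_compute.
apply/eq_in_map => l l_v; have := allP vars_lt7 _ l_v.
suff : all (gtn 7) l -> bval base_config l = (bval_int l)%:~R.
  by move=> H /H ->; rewrite /sgr intr_eq0 ltrz0.
case: l {l_v} => [|a [|b [|c [|d [|e [|g [|? ?]]]]]]] //=.
  by move=> /and4P[? ? ? _]; rewrite dE.
move=> /and5P[? ? ? ? /and3P[? ? _]]; rewrite /con !dE // -!rmorphM -rmorphB.
exact: erefl.
Qed.

Definition realizes (fs : seq (config R)) (cs : seq (seq sgn)) : Prop :=
  size fs = size cs /\ forall i, (i < size cs)%N ->
    [/\ sv (nth base_config fs i) = nth [::] cs i, typical (nth base_config fs i)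
      & conn (nth base_config fs i)].

(** The tree is run on configurations and on sign vectors in parallel, so each class inherits both a
    realization and connectedness from its parent. *)
Lemma realizes_tree tr fs cs : realizes fs cs -> tree_ok (size cs) tr ->
  realizes (foldl (fun fs jp => rcons fs (Cr (relab jp.2 (nth base_config fs jp.1)))) fs tr)
    (foldl (fun cs jp => rcons cs (crs (act jp.2 (nth [::] cs jp.1)))) cs tr).
Proof.
elim: tr fs cs => [|[j p] tr IHtr] fs cs /= [fs_cs H]; first by split.
move=> /and4P[j_lt p_ok q_ok tr_ok]; apply: IHtr; last by rewrite size_rcons.
have [sj tj cj] := H j j_lt; have [pp _] := andP p_ok.
have rt : typical (relab p (nth base_config fs j)).
  by apply: typical_same tj; exact: (same_relab (n := 7)).
split=> [|i]; first by rewrite !size_rcons fs_cs.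
rewrite size_rcons ltnS leq_eqVlt !nth_rcons fs_cs => /predU1P[->|i_lt]; last first.
  by rewrite i_lt; exact: H.
rewrite ltnn eqxx; split.
- by rewrite sv_Cr // sv_relab // sj.
- exact: typical_Cr.
- by apply: conn_Cr => //; exact: conn_relab.
Qed.

Definition reps : seq (config R) :=
  foldl (fun fs jp => rcons fs (Cr (relab jp.2 (nth base_config fs jp.1)))) [:: base_config] tree.
Definition rep i : config R := nth base_config reps i.

Lemma reps_ok i : (i < 14)%N ->
  [/\ sv (rep i) = nth [::] classes i, typical (rep i) & conn (rep i)].
Proof.
have base_ok : realizes [:: base_config] [:: s0].
  split=> // -[] // _; split; [exact: sv_base | exact: typical_s0 sv_base|].
  by move=> g h; rewrite sv_base; exact: s0_connected.
have [_ H] := realizes_tree base_ok tree_is_ok.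
have sz : size classes = 14%N by vm_compute.
by rewrite -sz => /H.
Qed.

End Representatives.

Section Components.
Variable R : realType.
Implicit Types (f g h : config R).

Lemma deriv_code_eq_sv f g : typical f -> sv f = sv g -> deriv_code f = deriv_code g.
Proof.
move=> ft fg; have gt := typical_sv (esym fg) ft.
have dE m : delta f m = delta g m.
  rewrite /delta /ncomp_adj; have -> : adj_rel f [set~ m] = adj_rel g [set~ m].
    by apply/funext => i; apply/funext => j; rewrite !adj_sv // fg.
  exact: erefl.
have cE (F G : 'I_7 -> nat) : F =1 G -> forall n, #|[set m | F m == n]| = #|[set m | G m == n]|.
  by move=> FG n; apply: eq_card => m; rewrite !inE FG.
exact: congr4 (cE _ _ dE 1%N) (cE _ _ dE 2%N) (cE _ _ dE 3%N) (cE _ _ dE 6%N).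
Qed.

Lemma apartF f g : same_config g f -> apart (sv f) (sv g) = false.
Proof.
move=> /same_configP[s [k k0 ->]]; apply/negP => /allP.
pose p : seq nat := [seq nat_of_ord (s (inord x)) | x <- pts].
pose e : bitseq := [seq k (inord x) < 0 | x <- pts].
have pE : (fun i => f (s i)) = relab p f.
  apply/funext => i; congr f; rewrite /p.
  by rewrite (nth_map 0%N) ?size_iota // nth_iota // add0n !inord_val.
have pp : p \in permutations pts.
  rewrite mem_permutations; apply: uniq_perm; rewrite ?iota_uniq //.
    rewrite map_inj_in_uniq ?iota_uniq // => x y; rewrite !mem_pts => x7 y7.
    by move=> /val_inj/perm_inj/(congr1 val); rewrite /= !inordK.
  move=> x; rewrite mem_pts; apply/mapP/idP => [[y _ ->]|x7]; first exact: ltn_ord.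
  exists (nat_of_ord (s^-1 (inord x))%g); first by rewrite mem_pts ltn_ord.
  by rewrite inord_val permKV inordK.
have sound e' l : l \in vars -> flip e' l = flip e l ->
    mismatch (sv f) (sv (scale k (relab p f))) e' p l = false.
  move=> l_v e'E; rewrite /mismatch /sv (nth_map [::]) ?index_mem // nth_index //.
  rewrite -[[seq sgr (bval f l) | l <- vars]]/(sv f) -{1}(take_nvars7 f).
  case E: (lk _ _) => [b|] //; have {}E := lk_take_Some E.
  have l7 := allP vars_lt7 _ l_v.
  rewrite bval_scale // bval_relab // E /= e'E /flip.
  set u := (_ && _); set w := (_ && _); suff -> : u = w by rewrite eqxx.
  rewrite /u /w; congr andb; elim: l l7 {l_v e'E E u w} => //= i l IHl /andP[i7 /IHl ->].
  by rewrite /e (nth_map 0%N) ?size_iota // nth_iota.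
(* On conic brackets flips have no effect, so the empty list of flips tried by [apart] is as good as
   [e]. *)
have szE e' o : o \in pts -> flip e' (six o) = false.
  have sz6 : all (fun o => size (six o) == 6%N) pts by [].
  by move=> /(allP sz6)/eqP E; rewrite /flip E.
move=> /(_ _ pp); rewrite pE; case: ifP => [/some_has[l /mapP[m m7 ->]]|_ /allP].
  by rewrite sound ?szE //; exact: (allP six_vars).
move=> /(_ e); have {1}-> : 7%N = size e by rewrite size_map.
by move=> /(_ (mem_bits e))/some_has[l l_v]; rewrite sound.
Qed.

(** A path ends at [g] only up to relabelling and scaling. Applying these to the whole path makes it
    end at [g] itself, and the constant signs can then be read at its start. *)
Lemma path_sv f g : path_in (@typical R) f g -> exists2 h, same_config h f & sv h = sv g.
Proof.
move=> [v [cv tv v0 /same_sym/same_configP[s [k k0 gE]]]].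
pose w i t := k i *: v (s i) t.
have wE t : same_config (fun i => w i t) (fun i => v i t).
  by exists s => i; exists (k i).
exists (fun i => w i 0); first exact: same_trans (wE 0) v0.
rewrite gE -[scale _ _]/(fun i => w i 1); apply/esym; apply: sv_path.
- by move=> i; apply: continuous_scale; [exact: cst_continuous | exact: cv].
- by move=> t t01; apply: typical_same (wE t) (tv t t01).
- by rewrite ler01 lexx.
Qed.

Lemma path_sub (P Q : config R -> Prop) f g :
  (forall h, P h -> Q h) -> path_in P f g -> path_in Q f g.
Proof.
by move=> PQ [v [cv Pv v0 v1]]; exists v; split=> // t t01; apply: PQ; exact: Pv.
Qed.

Lemma path_code f g : path_in (@typical R) f g ->
  path_in (fun h => typical h /\ deriv_code h = deriv_code f) f g.
Proof.
move=> [v [cv tv v0 v1]]; have t00 : 0 <= (0 : R) <= 1 by rewrite lexx ler01.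
have ft : typical f := typical_same (same_sym v0) (tv 0 t00).
exists v; split; [exact: cv | move=> t t01 | exact: v0 | exact: v1].
have tt := tv t t01; split; first exact: tt.
rewrite (deriv_code_eq_sv tt (sv_path cv tv t01)).
exact (deriv_code_same ft v0).
Qed.

Lemma deriv_code_rep i : (i < 14)%N -> deriv_code (rep R i) = nth (0, 0, 0, 0)%N codes i.
Proof.
move=> i14; have [svi ti _] := reps_ok R i14.
have i14' : (i < size classes)%N by have -> : size classes = 14%N by vm_compute.
have ok : codes_ok (sv (rep R i)) by rewrite svi; apply: (allP codes_ok_classes); exact: mem_nth.
by rewrite (deriv_code_sv ti ok) svi -codes_classes (nth_map [::]).
Qed.

Lemma path_reps i j : (i < 14)%N -> (j < 14)%N ->
  path_in (@typical R) (rep R i) (rep R j) -> i = j.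
Proof.
move=> i14 j14 /path_sv[h hi hj].
have [svi ti _] := reps_ok R i14; have [svj tj _] := reps_ok R j14.
have ht := typical_same hi ti.
have cij : nth (0, 0, 0, 0)%N codes i = nth (0, 0, 0, 0)%N codes j.
  have := etrans (deriv_code_same ti hi) (deriv_code_rep i14).
  by rewrite (etrans (deriv_code_eq_sv ht hj) (deriv_code_rep j14)).
have ap m n : (m < n)%N -> (n < 14)%N ->
    nth (0, 0, 0, 0)%N codes m = nth (0, 0, 0, 0)%N codes n ->
    apart (nth [::] classes m) (nth [::] classes n).
  move=> mn n14 cmn; have := allP (allP classes_apart m _) n _.
  by rewrite !mem_iota => /(_ (ltn_trans mn n14) n14); rewrite mn cmn eqxx.
case: (ltngtP i j) => // ij.
- by have := ap _ _ ij j14 cij; rewrite -svi -svj -hj (apartF hi).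
- by have := ap _ _ ij i14 (esym cij); rewrite -svi -svj -hj (apartF (same_sym hi)).
Qed.

(** The sign vector found by the classification is that of a rescaled representative; undoing the
    scaling gives a realization to which [conn] applies. *)
Lemma path_to_rep g : typical g -> exists2 i, (i < 14)%N & path_in (@typical R) g (rep R i).
Proof.
move=> gt; have [g' g'g [i]] := classification gt.
have -> : size classes = 14%N by vm_compute.
move=> i14 svg'; exists i => //; have [svi ti ci] := reps_ok R i14.
have [k k0] := norm_sv (rep R i) (nvars 7); rewrite !take_nvars7 svi -svg' => E.
have k0' j : (k j)^-1 != 0 by rewrite invr_eq0.
apply: (@path_same _ (@typical R) (scale (fun j => (k j)^-1) g') g (rep R i)).
- exact: same_trans (same_scale _ k0') g'g.
- exact: same_refl.
apply: epath_path; apply: ci => [|//].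
by rewrite (reor_sv _ k0') -E -(reor_sv _ k0') scaleK.
Qed.

(** Codes are constant along paths, so a set of typical configurations defined by codes is a union
    of path components; the predicate [a] lets one count serve the whole space and each [QC]. *)
Lemma components (P : config R -> Prop) (a : pred (nat * nat * nat * nat)) :
  (forall f, P f <-> typical f /\ a (deriv_code f)) -> n_path_components P (count a codes).
Proof.
move=> PE; pose c i := nth (0, 0, 0, 0)%N codes i; pose idx := [seq i <- iota 0 14 | a (c i)].
have -> : count a codes = size idx.
  by rewrite size_filter -[codes in LHS](mkseq_nth (0, 0, 0, 0)%N) count_map.
have idxP (m : 'I_(size idx)) : (nth 0%N idx m < 14)%N && a (c (nth 0%N idx m)).
  by have := mem_nth 0%N (ltn_ord m); rewrite mem_filter mem_iota andbC.
exists (fun m => rep R (nth 0%N idx m)); split.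
- move=> m; have /andP[m14 am] := idxP m; have [_ tm _] := reps_ok R m14.
  by apply/PE; split=> //; rewrite deriv_code_rep.
- move=> m n mn mn_path; have /andP[m14 _] := idxP m; have /andP[n14 _] := idxP n.
  have {}mn_path : path_in (@typical R) (rep R (nth 0%N idx m)) (rep R (nth 0%N idx n)).
    by apply: path_sub mn_path => h /PE[].
  move: mn => /negP[]; rewrite -val_eqE /= -(@nth_uniq _ 0%N idx) ?ltn_ord //.
    by apply/eqP; exact: path_reps mn_path.
  by rewrite filter_uniq ?iota_uniq.
move=> g /PE[gt ag]; have [i i14 gi] := path_to_rep gt.
have i_idx : i \in idx.
  have [h hg hi] := path_sv gi; have ht := typical_same hg gt.
  move: ag; rewrite -(etrans (esym (deriv_code_eq_sv ht hi)) (deriv_code_same gt hg)).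
  by rewrite (deriv_code_rep i14) mem_filter mem_iota i14 => ->.
move: (i_idx); rewrite -index_mem => i_lt; exists (Ordinal i_lt).
rewrite /= nth_index //; apply: path_sub (path_code gi) => h [ht hc].
by apply/PE; exact: conj ht (etrans (congr1 a hc) ag).
Qed.

End Components.

Theorem theorem1p1 (R : realType) :
  [/\ n_path_components (@typical R) 14,
      n_path_components (@QC R (3, 4, 0, 0)%N) 2,
      n_path_components (@QC R (2, 2, 3, 0)%N) 3
    & forall sg : nat * nat * nat * nat,
        sg \in [:: (7, 0, 0, 0); (1, 2, 2, 2); (1, 0, 6, 0); (1, 6, 0, 0);
                   (1, 4, 2, 0); (1, 2, 4, 0); (0, 4, 3, 0); (0, 6, 1, 0);
                   (0, 3, 3, 1)]%N ->
        n_path_components (@QC R sg) 1].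
Proof.
have QC_components sg : n_path_components (@QC R sg) (count_mem sg codes).
  by apply: components => f; split=> -[ft /eqP fc]; split=> //; apply/eqP.
split.
- by apply: (@components R (@typical R) predT) => f; split=> [|[]].
- exact: (QC_components (3, 4, 0, 0)%N).
- exact: (QC_components (2, 2, 3, 0)%N).
move=> sg sg_in; have <- : count_mem sg codes = 1%N.
  by move: sg_in; rewrite !inE; do ![case/orP|move/eqP => ->].
exact: QC_components.
Qed.
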